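(* Let $k$ be a number field and let $\pi:\mathcal{Q}^1\to\mathbb{P}^1$ be a smooth conic bundle of type $(2,2,0)$ over $k$. Then the set of $k$-points $\mathcal{Q}^1(k)$ is (Zariski) dense in $\mathcal{Q}^1$ if and only if $\mathcal{Q}^1$ has a $k$-point on a smooth fiber of $\pi$.
   Context: A conic bundle of type $(2,2,0)$ is a surface $$\mathcal{Q}^1=\{\sigma_{0,0}y_0^2+\sigma_{0,1}y_0y_1+\sigma_{0,2}y_0y_2+\sigma_{1,1}y_1^2+\sigma_{1,2}y_1y_2+\sigma_{2,2}y_2^2=0\}\subset\mathbb{P}(\mathcal{O}_{\mathbb{P}^1}(2)\oplus\mathcal{O}_{\mathbb{P}^1}(2)\oplus\mathcal{O}_{\mathbb{P}^1})$$ with $\sigma_{0,0},\sigma_{0,1},\sigma_{1,1}\in k[x_0,x_1]_4$, $\sigma_{0,2},\sigma_{1,2}\in k[x_0,x_1]_2$, $\sigma_{2,2}\in k$, where the projective bundle is the toric variety with Cox ring $k[x_0,x_1,y_0,y_1,y_2]$, $\deg x_i=(1,0)$, $\deg y_0=\deg y_1=(-2,1)$, $\deg y_2=(0,1)$, irrelevant ideal $(x_0,x_1)\cap(y_0,y_1,y_2)$; $\pi$ is the projection to $\mathbb{P}^1_{[x_0:x_1]}$, and the quadratic form is generically nondegenerate. By a convention of the paper, for all conic bundles considered the diagonal coefficients $\sigma_{i,i}$ are not identically zero. *)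

(* Defs.v *)
From HB Require Import structures.
From mathcomp Require Import all_boot all_order all_algebra all_field.
From mathcomp.multinomials Require Import mpoly.

Set Implicit Arguments.
Unset Strict Implicit.
Unset Printing Implicit Defensive.

Import GRing.Theory.
Local Open Scope ring_scope.

(* Coordinates of the Cox ring are indexed by 'I_(2 + 3): the first block is
   x_0, x_1 and the second block is y_0, y_1, y_2. *)
Definition ix (i : 'I_2) : 'I_(2 + 3) := lshift 3 i.
Definition iy (j : 'I_3) : 'I_(2 + 3) := rshift 2 j.

Definition y0 : 'I_3 := @Ordinal 3 0 isT.
Definition y1 : 'I_3 := @Ordinal 3 1 isT.
Definition y2 : 'I_3 := @Ordinal 3 2 isT.

Section Ambient.
Variable k : fieldType.

Definition cox_ring := {mpoly k[2 + 3]}.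

(* deg x_i = (1, 0), deg y_0 = deg y_1 = (-2, 1), deg y_2 = (0, 1). *)
Definition cox_deg (m : 'X_{1.. 2 + 3}) : int * int :=
  ((\sum_(i < 2) m (ix i))%N%:Z - (2 * (m (iy y0) + m (iy y1)))%N%:Z,
   (\sum_(j < 3) m (iy j))%N%:Z).

Definition bihomogeneous (F : cox_ring) : Prop :=
  exists d : int * int, forall m, m \in msupp F -> cox_deg m = d.

Definition eval_at (L : fieldType) (iota : {rmorphism k -> L})
    (v : 'I_(2 + 3) -> L) (F : cox_ring) : L := (map_mpoly iota F).@[v].

End Ambient.

(* Cox coordinates of an L-point of P(O(2) + O(2) + O), i.e. a tuple off the
   locus of the irrelevant ideal (x_0, x_1) /\ (y_0, y_1, y_2). Two tuples give
   the same point iff they differ by the action of the torus (L^* )^2, and every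
   L-point has such coordinates because the variety is smooth and toric with
   Cox ring as above. All the properties below are invariant under the torus. *)
Definition cox_point (L : fieldType) (v : 'I_(2 + 3) -> L) : Prop :=
  (exists i, v (ix i) != 0) /\ (exists j, v (iy j) != 0).

Record conic_coeffs (k : fieldType) := ConicCoeffs {
  s00 : {mpoly k[2]};
  s01 : {mpoly k[2]};
  s02 : {mpoly k[2]};
  s11 : {mpoly k[2]};
  s12 : {mpoly k[2]};
  s22 : k }.

Section ConicBundle.
Variables (k : fieldType) (s : conic_coeffs k).

Definition to_cox (p : {mpoly k[2]}) : cox_ring k :=
  p \mPo [tuple 'X_(ix i) | i < 2].

Definition conic_eq : cox_ring k :=
  let Y j : cox_ring k := 'X_(iy j) in
  to_cox (s00 s) * Y y0 ^+ 2 + to_cox (s01 s) * Y y0 * Y y1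
  + to_cox (s02 s) * Y y0 * Y y2 + to_cox (s11 s) * Y y1 ^+ 2
  + to_cox (s12 s) * Y y1 * Y y2 + (s22 s)%:MP * Y y2 ^+ 2.

(* Matrix of the polar bilinear form, i.e. twice the Gram matrix. *)
Definition polar_mx : 'M[{mpoly k[2]}]_3 :=
  let rows := [:: [:: s00 s *+ 2; s01 s; s02 s];
                  [:: s01 s; s11 s *+ 2; s12 s];
                  [:: s02 s; s12 s; (s22 s)%:MP *+ 2]] in
  \matrix_(i < 3, j < 3) nth 0 (nth [::] rows i) j.

(* The last conjunct says that the quadratic form in y is nondegenerate over
   k(x_0, x_1); this is the right condition in characteristic different from 2. *)
Definition conic_bundle_220 : Prop :=
  [/\ [/\ s00 s \is 4.-homog, s01 s \is 4.-homog & s11 s \is 4.-homog],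
      s02 s \is 2.-homog /\ s12 s \is 2.-homog,
      [/\ s00 s != 0, s11 s != 0 & s22 s != 0]
    & \det polar_mx != 0].

Definition point_on (L : fieldType) (iota : {rmorphism k -> L})
    (v : 'I_(2 + 3) -> L) : Prop :=
  cox_point v /\ eval_at iota v conic_eq = 0.

Definition rational_point (v : 'I_(2 + 3) -> k) : Prop := point_on idfun v.

(* Points of a k-scheme are tested on arbitrary field extensions L / k. Since
   the toric variety is the quotient of an open subset of A^5 by a torus acting
   freely, the Jacobian criterion may be applied in Cox coordinates. *)
Definition smooth_total_space : Prop :=
  forall (L : fieldType) (iota : {rmorphism k -> L}) (v : 'I_(2 + 3) -> L),
    point_on iota v ->
    exists i : 'I_(2 + 3), eval_at iota v (conic_eq^`M(i)) != 0.

(* Smoothness of the fiber of pi over the k-point [x_0 : x_1], a plane conic in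
   the coordinates y. *)
Definition smooth_fiber (x : 'I_2 -> k) : Prop :=
  forall (L : fieldType) (iota : {rmorphism k -> L}) (w : 'I_(2 + 3) -> L),
    point_on iota w -> (forall i, w (ix i) = iota (x i)) ->
    exists j : 'I_3, eval_at iota w (conic_eq^`M(iy j)) != 0.

(* Zariski closed subsets of the ambient toric variety are the zero loci of
   sets of bihomogeneous elements of the Cox ring. *)
Definition in_zero_locus (S : cox_ring k -> Prop) (L : fieldType)
    (iota : {rmorphism k -> L}) (v : 'I_(2 + 3) -> L) : Prop :=
  forall F, S F -> eval_at iota v F = 0.

(* Every closed subset containing all k-points contains the whole surface. *)
Definition rational_points_dense : Prop :=
  forall S : cox_ring k -> Prop,
    (forall F, S F -> bihomogeneous F) ->
    (forall v, rational_point v -> in_zero_locus S idfun v) ->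
    forall (L : fieldType) (iota : {rmorphism k -> L}) (v : 'I_(2 + 3) -> L),
      point_on iota v -> in_zero_locus S iota v.

Definition has_rational_point_on_smooth_fiber : Prop :=
  exists v, rational_point v /\ smooth_fiber (fun i => v (ix i)).

End ConicBundle.

(* Main.v *)
(* Completing the square in y_2 turns the surface into z^2 = F(x, y) with F of
   bidegree (4, 2), a double cover of P^1 x P^1. Every polynomial becomes
   R0 + R1 z on it and both signs of z are rational, so density follows from
   infinitely many smooth fibres of pi having a k-point (such a fibre is a conic
   with infinitely many k-points). Put the given smooth fibre at t = oo:
     z^2 = q t^4 + l t^3 + a t^2 + b t + c,  with q = y0^2 - d y1^2,
   l, a, b, c quadratic forms in (y0, y1). Over each k-point of the conic
   v^2 = q(y0, y1) this is a curve of genus 1 with two k-points at infinity, and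
   the point residual to twice one of them has
     t = (64 q^3 c - (4 q a - l^2)^2) / (8 q (l (4 q a - l^2) - 8 q^2 b)).
   This is a nonconstant function on the conic unless q divides l; then a
   translation gives l = 0. If moreover b <> 0, either t still moves, or its
   constant value t0 is the parameter of a fibre with a k-point, and putting that
   fibre at infinity leads back to the first case. If l = b = 0, the two points at
   infinity differ by a 2-torsion point, and one uses instead, for varying m, the
   space curves of genus 1
     d h^2 = 2 psi y0 + a + m y1^2,  m h^2 + psi^2 = c,
   which map to the surface by t = h / y1 and z = y0 t^2 - psi. Choose the
   coordinates so that y1 vanishes at a k-point of the conic. For every e in k
   exactly one of these curves passes through a point (y0 : y1 : psi : h) =
   (1 : 0 : psi : e), and its osculating plane there cuts it in a further k-point;
   the t of that point is an odd function of e with a pole at e = 0, hence takes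
   infinitely many values. *)
Require Import Defs.
From mathcomp Require Import all_boot all_order all_algebra all_field.
From mathcomp.multinomials Require Import mpoly.
From mathcomp Require Import ring.
From Stdlib Require Import Classical.

Set Implicit Arguments.
Unset Strict Implicit.
Unset Printing Implicit Defensive.

Import GRing.Theory.
Local Open Scope ring_scope.

(** * Infinite sets and nonconstant rational functions *)

Definition infinite (T : eqType) (P : T -> Prop) :=
  forall s : seq T, exists2 x, P x & x \notin s.

Lemma infinite_sub (T : eqType) (P Q : T -> Prop) :
  (forall x, P x -> Q x) -> infinite P -> infinite Q.
Proof. by move=> PQ iP s; have [x /PQ Qx xs] := iP s; exists x. Qed.

Lemma infinite_avoid (T : eqType) (P : T -> Prop) (s : seq T) :
  infinite P -> infinite (fun x => P x /\ x \notin s).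
Proof.
move=> iP u; have [x Px] := iP (s ++ u).
by rewrite mem_cat negb_or => /andP[xs xu]; exists x.
Qed.

Lemma infinite_image (T U : eqType) (P : T -> Prop) (g : T -> U) :
  infinite P ->
  (forall y, exists s : seq T, forall x, P x -> g x = y -> x \in s) ->
  infinite (fun y => exists2 x, P x & g x = y).
Proof.
move=> iP fin_fib s.
have [r rP] : exists r : seq T, forall x, P x -> g x \in s -> x \in r.
  elim: s => [|y s [r rP]]; first by exists [::].
  have [u uP] := fin_fib y; exists (u ++ r) => x Px.
  rewrite inE mem_cat => /orP[/eqP gx|gx]; first by rewrite uP.
  by rewrite rP ?orbT.
have [x Px xr] := iP r; exists (g x); first by exists x.
by apply: contra xr; apply: rP.
Qed.

Section Poly.
Variable k : fieldType.

Lemma poly_roots_finite (p : {poly k}) :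
  p != 0 -> exists s : seq k, forall x, root p x -> x \in s.
Proof.
elim: {p}(size p) {-2}p (leqnn (size p)) => [|n IHn] p.
  by rewrite leqn0 size_poly_eq0 => /eqP->; rewrite eqxx.
move=> szp p0; have [[a pa]|nor] := classic (exists a, root p a); last first.
  by exists [::] => x px; case: nor; exists x.
have [q def_p] := factor_theorem p a pa.
have q0 : q != 0 by apply: contraNneq p0 => q0; rewrite def_p q0 mul0r.
have [|s sP] := IHn q _ q0.
  by move: szp; rewrite def_p size_Mmonic ?monicXsubC // size_XsubC addn2.
exists (a :: s) => x; rewrite def_p rootM root_XsubC inE => /orP[/sP->|->] //.
by rewrite orbT.
Qed.

Lemma infinite_nonroot (P : k -> Prop) (p : {poly k}) :
  infinite P -> p != 0 -> infinite (fun x => P x /\ p.[x] != 0).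
Proof.
move=> iP /poly_roots_finite[s sP]; apply: infinite_sub (infinite_avoid s iP).
by move=> x [Px xs]; split=> //; apply: contra xs => /sP.
Qed.

Lemma infinite_poly0 (P : k -> Prop) (p : {poly k}) :
  infinite P -> (forall x, P x -> p.[x] = 0) -> p = 0.
Proof.
move=> iP p0; apply/eqP/negPn/negP => /(infinite_nonroot iP) /(_ [::])[x [/p0->]].
by rewrite eqxx.
Qed.

(** Each fibre of [g] lies among the roots of one of the nonzero polynomials [N - y *: D]; for
    nonzero [D] the last hypothesis says that [N / D] is not constant. *)
Lemma infinite_rational_image (P : k -> Prop) (g : k -> k) (N D : {poly k}) :
  infinite P -> (forall x, P x -> g x * D.[x] = N.[x]) ->
  (forall y, N - y *: D != 0) -> infinite (fun y => exists2 x, P x & g x = y).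
Proof.
move=> iP gE ND; apply: infinite_image => // y.
have [s sP] := poly_roots_finite (ND y); exists s => x /gE gx gy; apply: sP.
by rewrite rootE !hornerE -gx gy subrr.
Qed.

Hypothesis char0 : [pchar k] =i pred0.

Lemma pchar0_natr_neq0 n : n.+1%:R != 0 :> k.
Proof. by rewrite (pcharf0P k).1. Qed.

Lemma infinite_pchar0 : infinite (fun _ : k => True).
Proof.
move=> s; apply: NNPP => nex.
have sub : {subset [seq n%:R | n <- iota 0 (size s).+1] <= s}.
  by move=> x _; apply: contra_notT nex => xs; exists x.
have /uniq_leq_size/(_ sub) : uniq [seq n%:R : k | n <- iota 0 (size s).+1].
  rewrite map_inj_uniq ?iota_uniq // => i j.
  wlog le_ij : i j / (i <= j)%N => [W|].
    by case: (leqP i j) => [le_ij|/ltnW le_ji] ij; [apply: W | apply/esym/W].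
  move/eqP; rewrite eq_sym -subr_eq0 -natrB // (pcharf0P k).1 //.
  by rewrite subn_eq0 => le_ji; apply/eqP; rewrite eqn_leq le_ij.
by rewrite size_map size_iota ltnn.
Qed.
End Poly.

(** * Space curves of genus 1 and their osculating planes *)

Section OsculatingPlane.
Variable k : fieldType.

(** When the two equations are used to eliminate the forms a and c, the terms in [m] cancel because
    y1 t = h. So every value of [m] gives a curve mapping to the surface. *)
Lemma halphen_curve_square (d A0 A1 A2 C0 C1 C2 m y0 y1 psi h : k) :
  y1 != 0 ->
  d * h ^+ 2 = 2 * psi * y0 + (A0 * y0 ^+ 2 + A1 * y0 * y1 + A2 * y1 ^+ 2) + m * y1 ^+ 2 ->
  m * h ^+ 2 + psi ^+ 2 = C0 * y0 ^+ 2 + C1 * y0 * y1 + C2 * y1 ^+ 2 ->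
  (y0 * (h / y1) ^+ 2 - psi) ^+ 2 = (y0 ^+ 2 - d * y1 ^+ 2) * (h / y1) ^+ 4
    + (A0 * y0 ^+ 2 + A1 * y0 * y1 + A2 * y1 ^+ 2) * (h / y1) ^+ 2
    + (C0 * y0 ^+ 2 + C1 * y0 * y1 + C2 * y1 ^+ 2).
Proof.
move=> y1n0 e1 e2; rewrite -e2.
have -> : A0 * y0 ^+ 2 + A1 * y0 * y1 + A2 * y1 ^+ 2 =
  d * h ^+ 2 - 2 * psi * y0 - m * y1 ^+ 2 by rewrite e1; ring.
by field.
Qed.

(** The six equations before [M] are the coefficients of 1, y1, y1^2 after putting e + e1 y1 + e2
    y1^2 for h and psi + p1 y1 + p2 y1^2 for psi, with y0 = 1. The osculating plane is spanned by
    (1, 0, psi, e), (0, 1, p1, e1), (0, 0, p2, e2); in its coordinates (y0, y1, w) the residual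
    point lies on the line w = - K y1. *)
Lemma osculating_residual (d A0 A1 A2 C0 C1 C2 m e psi e1 e2 p1 p2 M K : k) :
  d != 0 ->
  d * e ^+ 2 = 2 * psi + A0 -> m * e ^+ 2 + psi ^+ 2 = C0 ->
  d * (2 * e * e1) = 2 * p1 + A1 -> m * (2 * e * e1) + 2 * psi * p1 = C1 ->
  d * (e1 ^+ 2 + 2 * e * e2) = 2 * p2 + A2 + m ->
    m * (e1 ^+ 2 + 2 * e * e2) + p1 ^+ 2 + 2 * psi * p2 = C2 ->
  M = m / d + psi ->
  let al := 2 * d * e * e2 - 2 * p2 in let be := 2 * d * e1 * e2 in let ga := d * e2 ^+ 2 in
  K * (al * p2 - 2 * M * ga) = 2 * (al * p1 - M * be) ->
  M != 0 ->
  let y1 := 2 * M * K in let y0 := p2 * K ^+ 2 - 2 * p1 * K - 2 * M in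
  let ps := psi * y0 + p1 * y1 - p2 * K * y1 in let h := e * y0 + e1 * y1 - e2 * K * y1 in
  d * h ^+ 2 = 2 * ps * y0 + (A0 * y0 ^+ 2 + A1 * y0 * y1 + A2 * y1 ^+ 2) + m * y1 ^+ 2 /\
  m * h ^+ 2 + ps ^+ 2 = C0 * y0 ^+ 2 + C1 * y0 * y1 + C2 * y1 ^+ 2.
Proof.
move=> dn0 h1 h2 h3 h4 h5 h6 hM al be ga hK Mn0 y1 y0 ps h.
have eA0 : A0 = d * e ^+ 2 - 2 * psi by rewrite h1; ring.
have eA1 : A1 = d * (2 * e * e1) - 2 * p1 by rewrite h3; ring.
have eA2 : A2 = d * (e1 ^+ 2 + 2 * e * e2) - 2 * p2 - m by rewrite h5; ring.
have em : m = d * (M - psi) by rewrite hM; field.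
(* With w = - K y1 this is the first quadric restricted to the plane, al (y0 w - y1^2) + be y1 w +
   ga w^2. Eliminating y0 w - y1^2 between it and the conic of [J0] leaves w = 0 and the line that
   determines [K]. *)
have I0 : al * (-K * y0 * y1 - y1 ^+ 2) - be * K * y1 ^+ 2 + ga * K ^+ 2 * y1 ^+ 2 = 0.
  have -> : al * (-K * y0 * y1 - y1 ^+ 2) - be * K * y1 ^+ 2 + ga * K ^+ 2 * y1 ^+ 2 =
    2 * M * K ^+ 3 * (2 * (al * p1 - M * be) - K * (al * p2 - 2 * M * ga)).
    rewrite /y1 /y0; ring.
  by rewrite hK; ring.
(* This conic comes from eliminating h^2 between the two quadrics and removing a factor [p2]; [y0]
   and [y1] were chosen to solve it on the line. *)
have J0 : 2 * M * (-K * y0 * y1 - y1 ^+ 2) - 2 * p1 * K * y1 ^+ 2 + p2 * K ^+ 2 * y1 ^+ 2 = 0.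
  rewrite /y1 /y0; ring.
have I : d * h ^+ 2 = 2 * ps * y0 + (A0 * y0 ^+ 2 + A1 * y0 * y1 + A2 * y1 ^+ 2) + m * y1 ^+ 2.
  apply/eqP; rewrite -subr_eq0; apply/eqP; rewrite -I0 eA0 eA1 eA2 /h /ps /al /be /ga; ring.
split=> //.
have -> : m * h ^+ 2 = (M - psi) * (d * h ^+ 2) by rewrite em; ring.
rewrite I -h2 -h4 -h6 eA0 eA1 eA2 em.
apply/eqP; rewrite -subr_eq0; apply/eqP.
rewrite -[RHS](mulr0 p2) -J0 /ps; ring.
Qed.
End OsculatingPlane.

Section ResidualFormulas.
Variables (R : comPzRingType) (d A0 A1 A2 C0 C1 C2 E : R).
(* Numerators, as polynomials in [E = e^2], for the point residual to three times
   [(y0 : y1 : psi : h) = (1 : 0 : psi : e)]. There [psi = osc_P / 2],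
   [m = osc_S / (4 E)], [m / d + psi = osc_w / (4 d E)]; at this point
   [h = e + e1 y1 + e2 y1^2 + ...] with [e1 = e osc_g / osc_w],
   [e2 = osc_x / (4 d e osc_w^3)], and [psi] has second-order coefficient
   [osc_p / (8 E osc_w^3)]. The residual point has [t = e osc_num / osc_den]. *)
Definition osc_P := d * E - A0.
Definition osc_S := 4%:R * C0 - osc_P ^+ 2.
Definition osc_w := osc_S + 2%:R * d * osc_P * E.
Definition osc_g := 2%:R * C1 + A1 * osc_P.
Definition osc_a := 4%:R * E * osc_w ^+ 2 * A2 + osc_S * osc_w ^+ 2
  - 4%:R * d * E ^+ 2 * osc_g ^+ 2.
Definition osc_y := d * (osc_w * (osc_P + 2%:R * A0) * (4%:R * E * A2 + osc_S)
  + E * (2%:R * osc_g ^+ 2 - 8%:R * C2 * osc_w - 8%:R * d * E * osc_g * A1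
    + 2%:R * A1 ^+ 2 * osc_w)).
Definition osc_n := osc_g * osc_y - d * A1 * osc_a.
Definition osc_x := 2%:R * d ^+ 2 * E * osc_a - osc_w * osc_y.
Definition osc_D := osc_x * osc_y - d ^+ 2 * osc_a ^+ 2.
Definition osc_p := 2%:R * E * osc_x - osc_w * osc_a.
Definition osc_num := 16%:R * d * E * osc_n ^+ 2 * (d ^+ 2 * E * osc_p - osc_w * osc_x)
  + 8%:R * d * E * osc_n * osc_D * (osc_g * osc_w - 4%:R * d ^+ 2 * E ^+ 2 * osc_g
    + 2%:R * d * E * A1 * osc_w)
  - osc_D ^+ 2.
Definition osc_den := 8%:R * d * E * osc_w ^+ 2 * osc_n * osc_D.
End ResidualFormulas.

Section ResidualMorphisms.
Variables (R S : comPzRingType) (f : {rmorphism R -> S}) (d A0 A1 A2 C0 C1 C2 E : R).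
Let rm := (rmorph_nat, rmorphXn, rmorphB, rmorphD, rmorphN, rmorphM).
(** Applied to evaluation [{poly k} -> k], these lemmas turn the formulas taken at ['X] into their
    values at a scalar. *)
Lemma osc_P_morph : f (osc_P d A0 E) = osc_P (f d) (f A0) (f E).
Proof. by rewrite /osc_P !rm. Qed.
Lemma osc_S_morph : f (osc_S d A0 C0 E) = osc_S (f d) (f A0) (f C0) (f E).
Proof. rewrite /osc_S -osc_P_morph; move: (osc_P _ _ _) => t0; by rewrite !rm. Qed.
Lemma osc_w_morph : f (osc_w d A0 C0 E) = osc_w (f d) (f A0) (f C0) (f E).
Proof.
rewrite /osc_w -osc_P_morph -osc_S_morph; move: (osc_P _ _ _) (osc_S _ _ _ _) => t0 t1;
  by rewrite !rm.
Qed.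
Lemma osc_g_morph : f (osc_g d A0 A1 C1 E) = osc_g (f d) (f A0) (f A1) (f C1) (f E).
Proof. rewrite /osc_g -osc_P_morph; move: (osc_P _ _ _) => t0; by rewrite !rm. Qed.
Lemma osc_a_morph : f (osc_a d A0 A1 A2 C0 C1 E) =
  osc_a (f d) (f A0) (f A1) (f A2) (f C0) (f C1) (f E).
Proof.
rewrite /osc_a -osc_g_morph -osc_S_morph -osc_w_morph;
  move: (osc_g _ _ _ _ _) (osc_S _ _ _ _) (osc_w _ _ _ _) => t0 t1 t2; by rewrite !rm.
Qed.
Lemma osc_y_morph : f (osc_y d A0 A1 A2 C0 C1 C2 E) =
  osc_y (f d) (f A0) (f A1) (f A2) (f C0) (f C1) (f C2) (f E).
Proof.
rewrite /osc_y -osc_g_morph -osc_S_morph -osc_w_morph -osc_P_morph;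
  move: (osc_g _ _ _ _ _) (osc_S _ _ _ _) (osc_w _ _ _ _) (osc_P _ _ _) => t0 t1 t2 t3;
  by rewrite !rm.
Qed.
Lemma osc_n_morph : f (osc_n d A0 A1 A2 C0 C1 C2 E) =
  osc_n (f d) (f A0) (f A1) (f A2) (f C0) (f C1) (f C2) (f E).
Proof.
rewrite /osc_n -osc_g_morph -osc_a_morph -osc_y_morph;
  move: (osc_g _ _ _ _ _) (osc_a _ _ _ _ _ _ _) (osc_y _ _ _ _ _ _ _ _) => t0 t1 t2; by rewrite !rm.
Qed.
Lemma osc_x_morph : f (osc_x d A0 A1 A2 C0 C1 C2 E) =
  osc_x (f d) (f A0) (f A1) (f A2) (f C0) (f C1) (f C2) (f E).
Proof.
rewrite /osc_x -osc_w_morph -osc_a_morph -osc_y_morph;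
  move: (osc_w _ _ _ _) (osc_a _ _ _ _ _ _ _) (osc_y _ _ _ _ _ _ _ _) => t0 t1 t2; by rewrite !rm.
Qed.
Lemma osc_D_morph : f (osc_D d A0 A1 A2 C0 C1 C2 E) =
  osc_D (f d) (f A0) (f A1) (f A2) (f C0) (f C1) (f C2) (f E).
Proof.
rewrite /osc_D -osc_a_morph -osc_x_morph -osc_y_morph;
  move: (osc_a _ _ _ _ _ _ _) (osc_x _ _ _ _ _ _ _ _) (osc_y _ _ _ _ _ _ _ _) => t0 t1 t2;
  by rewrite !rm.
Qed.
Lemma osc_p_morph : f (osc_p d A0 A1 A2 C0 C1 C2 E) =
  osc_p (f d) (f A0) (f A1) (f A2) (f C0) (f C1) (f C2) (f E).
Proof.
rewrite /osc_p -osc_a_morph -osc_x_morph -osc_w_morph;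
  move: (osc_a _ _ _ _ _ _ _) (osc_x _ _ _ _ _ _ _ _) (osc_w _ _ _ _) => t0 t1 t2; by rewrite !rm.
Qed.
Lemma osc_num_morph : f (osc_num d A0 A1 A2 C0 C1 C2 E) =
  osc_num (f d) (f A0) (f A1) (f A2) (f C0) (f C1) (f C2) (f E).
Proof.
rewrite /osc_num -osc_n_morph -osc_D_morph -osc_p_morph -osc_x_morph -osc_w_morph -osc_g_morph;
  move: (osc_n _ _ _ _ _ _ _ _) (osc_D _ _ _ _ _ _ _ _) (osc_p _ _ _ _ _ _ _ _)
  (osc_x _ _ _ _ _ _ _ _) (osc_w _ _ _ _) (osc_g _ _ _ _ _) => t0 t1 t2 t3 t4 t5; by rewrite !rm.
Qed.
Lemma osc_den_morph : f (osc_den d A0 A1 A2 C0 C1 C2 E) =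
  osc_den (f d) (f A0) (f A1) (f A2) (f C0) (f C1) (f C2) (f E).
Proof.
rewrite /osc_den -osc_n_morph -osc_D_morph -osc_w_morph;
  move: (osc_n _ _ _ _ _ _ _ _) (osc_D _ _ _ _ _ _ _ _) (osc_w _ _ _ _) => t0 t1 t2; by rewrite !rm.
Qed.
End ResidualMorphisms.

Section InfiniteResiduals.
Variables (k : fieldType) (d A0 A1 A2 C0 C1 C2 : k).
Hypothesis char0 : [pchar k] =i pred0.
Hypothesis dn0 : d != 0.
Let two : 2%:R != 0 :> k. Proof. exact: pchar0_natr_neq0. Qed.

Let P := osc_P d A0. Let S := osc_S d A0 C0. Let w := osc_w d A0 C0.
Let g := osc_g d A0 A1 C1. Let a := osc_a d A0 A1 A2 C0 C1.
Let y := osc_y d A0 A1 A2 C0 C1 C2. Let n := osc_n d A0 A1 A2 C0 C1 C2.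
Let x7 := osc_x d A0 A1 A2 C0 C1 C2. Let D := osc_D d A0 A1 A2 C0 C1 C2.
Let p := osc_p d A0 A1 A2 C0 C1 C2. Let U := osc_num d A0 A1 A2 C0 C1 C2.
Let V := osc_den d A0 A1 A2 C0 C1 C2.

Lemma osculating_residual_point (e : k) : V (e ^+ 2) != 0 ->
  exists y0 y1 z, y1 != 0 /\
    let x := e * U (e ^+ 2) / V (e ^+ 2) in
    z ^+ 2 = (y0 ^+ 2 - d * y1 ^+ 2) * x ^+ 4
      + (A0 * y0 ^+ 2 + A1 * y0 * y1 + A2 * y1 ^+ 2) * x ^+ 2
      + (C0 * y0 ^+ 2 + C1 * y0 * y1 + C2 * y1 ^+ 2).
Proof.
set E := e ^+ 2 => Vn0.
(* The factors of [V] are what must be nonzero below: [E], [w], [D] occur in denominators, and [n]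
   makes the final y1 nonzero. *)
have [en0 wn0 nn0 Dn0] : [/\ e != 0, w E != 0, n E != 0 & D E != 0].
  split; apply: contraNneq Vn0 => z0; rewrite /V /osc_den.
  - by rewrite /E z0 expr0n /= mulr0 !mul0r.
  - by rewrite -/w z0 expr0n /= mulr0 !mul0r.
  - by rewrite -/n z0 mulr0 mul0r.
  - by rewrite -/D z0 mulr0.
have En0 : E != 0 by rewrite expf_eq0.
have four : 4%:R != 0 :> k by exact: pchar0_natr_neq0.
(* These solve [h1] to [h6] order by order: [psi] and [m] at order 0, [p1] and [e1] at order 1, [p2]
   and [e2] at order 2; [K] solves [hK]. *)
pose m := S E / (4%:R * E).
pose psi := P E / 2%:R.
pose M := w E / (4%:R * d * E).
pose p1 := (2%:R * d * E * g E - A1 * w E) / (2%:R * w E).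
pose e1 := e * g E / w E.
pose p2 := p E / (8%:R * E * w E ^+ 3).
pose e2 := x7 E / (4%:R * d * e * w E ^+ 3).
pose K := 8%:R * d * E * w E ^+ 2 * n E / D E.
have eight : 8%:R != 0 :> k by exact: pchar0_natr_neq0.
have eA0 : A0 = d * E - P E by rewrite /P /osc_P; ring.
have eS : S E = w E - 2 * d * P E * E by rewrite /w /osc_w -/(P E) -/(S E); ring.
have ea : a E = 4%:R * E * w E ^+ 2 * A2 + S E * w E ^+ 2 - 4%:R * d * E ^+ 2 * g E ^+ 2 by [].
have ex : x7 E = 2%:R * d ^+ 2 * E * a E - w E * y E by [].
have ep : p E = 2%:R * E * x7 E - w E * a E by [].
have h1 : d * e ^+ 2 = 2 * psi + A0.
  rewrite /psi /P /osc_P -/E; field; exact: two.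
have h2 : m * e ^+ 2 + psi ^+ 2 = C0.
  rewrite /m /psi /S /osc_S -/P /E; field;
    by rewrite ?(pchar0_natr_neq0 char0) ?en0 ?En0 ?wn0 ?dn0 ?Dn0 ?nn0.
have hM : M = m / d + psi.
  rewrite /M /m /psi /w /osc_w -/P -/S /E; field;
    by rewrite ?(pchar0_natr_neq0 char0) ?en0 ?En0 ?wn0 ?dn0 ?Dn0 ?nn0.
have h3 : d * (2 * e * e1) = 2 * p1 + A1.
  rewrite /e1 /p1 /E; field; by rewrite ?(pchar0_natr_neq0 char0) ?en0 ?En0 ?wn0 ?dn0 ?Dn0 ?nn0.
have h4 : m * (2 * e * e1) + 2 * psi * p1 = C1.
  have -> : C1 = (g E - A1 * P E) / 2%:R by rewrite /g /osc_g -/P; field; exact: two.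
  have -> : 2 * e * e1 = (2 * p1 + A1) / d by rewrite -h3; field; exact: dn0.
  have -> : psi = M - m / d by rewrite hM; ring.
  rewrite /p1 /M /m eS; field; by rewrite ?(pchar0_natr_neq0 char0) ?en0 ?En0 ?wn0 ?dn0 ?Dn0 ?nn0.
have h5 : d * (e1 ^+ 2 + 2 * e * e2) = 2 * p2 + A2 + m.
  rewrite /e1 /e2 /p2 /m ep; rewrite ea /E; field.
  by rewrite ?(pchar0_natr_neq0 char0) ?en0 ?En0 ?wn0 ?dn0 ?Dn0 ?nn0.
have h6 : m * (e1 ^+ 2 + 2 * e * e2) + p1 ^+ 2 + 2 * psi * p2 = C2.
  have -> : C2 = (w E * (P E + 2%:R * A0) * (4%:R * E * A2 + S E) + E * (2%:R * (g E) ^+ 2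
     - 8%:R * d * E * g E * A1 + 2%:R * A1 ^+ 2 * w E) - y E / d) / (8%:R * E * w E).
    rewrite /y /osc_y -/(P E) -/(w E) -/(S E) -/(g E) /E; field.
    by rewrite ?(pchar0_natr_neq0 char0) ?en0 ?En0 ?wn0 ?dn0 ?Dn0 ?nn0.
  rewrite /e1 /e2 /p2 /m /p1 /psi ep ex eA0 ea eS /E; field.
  by rewrite ?(pchar0_natr_neq0 char0) ?en0 ?En0 ?wn0 ?dn0 ?Dn0 ?nn0.
have hK : K * ((2 * d * e * e2 - 2 * p2) * p2 - 2 * M * (d * e2 ^+ 2)) =
  2 * ((2 * d * e * e2 - 2 * p2) * p1 - M * (2 * d * e1 * e2)).
  rewrite /K.
  have -> : (2 * d * e * e2 - 2 * p2) * p1 - M * (2 * d * e1 * e2) =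
    n E / (4 * d * E * w E ^+ 2) / 2.
    rewrite /n /osc_n -/(g E) -/(y E) -/(a E) /e2 /p2 /p1 /M /e1 ep ex /E; field.
    by rewrite ?(pchar0_natr_neq0 char0) ?en0 ?En0 ?wn0 ?dn0 ?Dn0 ?nn0.
  have -> : (2 * d * e * e2 - 2 * p2) * p2 - 2 * M * (d * e2 ^+ 2) =
    D E / (32%:R * d ^+ 2 * E ^+ 2 * w E ^+ 4).
    rewrite /D /osc_D -/(x7 E) -/(y E) -/(a E) /e2 /p2 /M ep ex /E; field.
    by rewrite ?(pchar0_natr_neq0 char0) ?en0 ?En0 ?wn0 ?dn0 ?Dn0 ?nn0.
  rewrite /E; field.
  by rewrite ?(pchar0_natr_neq0 char0) ?en0 ?En0 ?wn0 ?dn0 ?Dn0 ?nn0.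
have Mn0 : M != 0.
  by rewrite /M mulf_neq0 ?invr_neq0 ?mulf_neq0.
have [] := osculating_residual dn0 h1 h2 h3 h4 h5 h6 hM hK Mn0.
set y1 := 2 * M * K; set y0 := _ - 2 * M; set ps := _ - p2 * K * y1; set h := _ - e2 * K * y1.
move=> I J.
have y1n0 : y1 != 0.
  have e8 := pchar0_natr_neq0 char0 7; have e2' := pchar0_natr_neq0 char0 1.
  by rewrite /y1 /K ?(mulf_neq0, invr_neq0, expf_neq0).
have ex_ : e * U E / V E = h / y1.
  rewrite /h /y1 /y0 /V /U /osc_den /osc_num -/(n E) -/(D E) -/(p E) -/(w E) -/(x7 E) -/(g E).
  rewrite /e2 /e1 /p1 /p2 /K /M /E.
  field.
  by rewrite ?(pchar0_natr_neq0 char0) ?en0 ?En0 ?wn0 ?dn0 ?Dn0 ?nn0.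
exists y0, y1, (y0 * (h / y1) ^+ 2 - ps); split=> //=.
by rewrite ex_; apply: (halphen_curve_square (m := m)).
Qed.

Hypothesis C0n0 : C0 != 0.
Hypothesis dAC : A0 ^+ 2 != 4%:R * C0.
Hypothesis AC1 : (A1 != 0) || (C1 != 0).

(** A fifth difference is a nonzero multiple of C1; once C1 = 0, the value at 0 is a nonzero
    multiple of A1, against [AC1]. *)
Lemma osc_n_neq0 : ~ (forall E, n E = 0).
Proof.
move=> n0.
have C1z : C1 = 0.
  (* the fifth finite difference extracts the leading coefficient *)
  have : 0 = n 5%:R - 5%:R * n 4%:R + 10%:R * n 3%:R - 10%:R * n 2%:R + 5%:R * n 1 - n 0.
    by rewrite !n0; ring.
  have -> : n 5%:R - 5%:R * n 4%:R + 10%:R * n 3%:R - 10%:R * n 2%:R + 5%:R * n 1 - n 0 =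
    - 240%:R * d ^+ 6 * C1.
    rewrite /n /osc_n /osc_a /osc_y /osc_w /osc_S /osc_g /osc_P; ring.
  move/esym/eqP; apply: contraTeq => C1n.
  by rewrite ?(mulf_neq0, expf_neq0) // oppr_eq0 (pchar0_natr_neq0 char0 239).
have := n0 0.
have -> : n 0 = 2%:R * d * (4%:R * C0 - A0 ^+ 2) ^+ 2 * (C1 * A0 - 2%:R * A1 * C0).
  rewrite /n /osc_n /osc_a /osc_y /osc_w /osc_S /osc_g /osc_P; ring.
move: AC1; rewrite C1z eqxx orbF => A1n0; apply/eqP.
have w0n : 4%:R * C0 - A0 ^+ 2 != 0 by rewrite subr_eq0 eq_sym.
have t2 := pchar0_natr_neq0 char0 1.
by rewrite mul0r sub0r ?(mulf_neq0, expf_neq0) // oppr_eq0 ?mulf_neq0.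
Qed.

Lemma infinite_osculating_residuals :
  infinite (fun x : k => exists y0 y1 z, y1 != 0 /\
    z ^+ 2 = (y0 ^+ 2 - d * y1 ^+ 2) * x ^+ 4
      + (A0 * y0 ^+ 2 + A1 * y0 * y1 + A2 * y1 ^+ 2) * x ^+ 2
      + (C0 * y0 ^+ 2 + C1 * y0 * y1 + C2 * y1 ^+ 2)).
Proof.
pose Up := osc_num d%:P A0%:P A1%:P A2%:P C0%:P C1%:P C2%:P 'X.
pose Vp := osc_den d%:P A0%:P A1%:P A2%:P C0%:P C1%:P C2%:P 'X.
have UpE E : Up.[E] = U E.
  by rewrite /Up -[LHS]/(horner_eval E _) osc_num_morph /= !horner_evalE !(hornerC, hornerX).
have VpE E : Vp.[E] = V E.
  by rewrite /Vp -[LHS]/(horner_eval E _) osc_den_morph /= !horner_evalE !(hornerC, hornerX).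
have w0n : 4%:R * C0 - A0 ^+ 2 != 0 by rewrite subr_eq0 eq_sym.
(* Nonzero by [C0n0] and [dAC]; then U(0) = - D(0)^2 is nonzero, since the other terms of [osc_num]
   contain the factor [E]. *)
have D0 : D 0 = - 4%:R * d ^+ 2 * C0 * (4%:R * C0 - A0 ^+ 2) ^+ 5.
  rewrite /D /osc_D /osc_x /osc_a /osc_y /osc_w /osc_S /osc_g /osc_P; ring.
have D0n : D 0 != 0.
  by rewrite D0 ?(mulf_neq0, expf_neq0) // oppr_eq0 (pchar0_natr_neq0 char0 3).
have U0 : U 0 != 0.
  rewrite /U /osc_num -/(D 0) -/(n 0) !(mulr0, mul0r, add0r) oppr_eq0.
  by rewrite expf_neq0.
have Vp0 : Vp != 0.
  pose np := osc_n d%:P A0%:P A1%:P A2%:P C0%:P C1%:P C2%:P 'X.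
  pose Dp := osc_D d%:P A0%:P A1%:P A2%:P C0%:P C1%:P C2%:P 'X.
  pose wp := osc_w d%:P A0%:P C0%:P 'X.
  have npE E : np.[E] = n E.
    by rewrite /np -[LHS]/(horner_eval E _) osc_n_morph /= !horner_evalE !(hornerC, hornerX).
  have DpE E : Dp.[E] = D E.
    by rewrite /Dp -[LHS]/(horner_eval E _) osc_D_morph /= !horner_evalE !(hornerC, hornerX).
  have wpE E : wp.[E] = w E.
    by rewrite /wp -[LHS]/(horner_eval E _) osc_w_morph /= !horner_evalE !(hornerC, hornerX).
  have wp0 : wp != 0.
    apply: contraNneq w0n => w0; have := wpE 0; rewrite w0 horner0 /w /osc_w /osc_S /osc_P.
    by move=> /esym; rewrite !(mulr0, addr0) sub0r sqrrN => ->.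
  have np0 : np != 0.
    by apply/eqP => n0; apply: osc_n_neq0 => E; rewrite -npE n0 horner0.
  have Dp0 : Dp != 0 by apply: contraNneq D0n => D0z; rewrite -DpE D0z horner0.
  have c80 : 8%:R != 0 :> {poly k}.
    by rewrite -polyC_natr polyC_eq0 (pchar0_natr_neq0 char0 7).
  by rewrite /Vp /osc_den -/np -/Dp -/wp ?(mulf_neq0, expf_neq0) ?polyX_eq0 ?polyC_eq0.
have Vc0 : Vp \Po 'X^2 != 0.
  by rewrite comp_poly_eq0 // size_polyXn.
have iP := infinite_nonroot (infinite_pchar0 char0) Vc0.
pose x e := e * U (e ^+ 2) / V (e ^+ 2).
have VcE e : (Vp \Po 'X^2).[e] = V (e ^+ 2) by rewrite horner_comp hornerXn VpE.
have UcE e : (Up \Po 'X^2).[e] = U (e ^+ 2) by rewrite horner_comp hornerXn UpE.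
have := @infinite_rational_image _ _ x ('X * (Up \Po 'X^2)) _ iP _ _.
move=> /(_ (Vp \Po 'X^2)) H.
apply: infinite_sub (H _ _) => [_ [e [_ Ve] <-]|e [_ Ve]|c].
- by apply: osculating_residual_point; rewrite -VcE.
- by rewrite VcE hornerM hornerX UcE /x divfK // -VcE.
(* The derivative of X U(X^2) - c V(X^2) at 0 is U(0), because V(X^2) is even. *)
- apply: contraNneq U0 => /(congr1 (fun p => p^`().[0])).
  rewrite derivB derivM derivZ derivX !deriv_comp derivXn !hornerE.
  by rewrite UcE !expr0n /= mulr0 subr0 deriv0 horner0 => ->.
Qed.
End InfiniteResiduals.

(** * Extension fields and binary quadratic forms *)

Lemma root_in_extension (k : fieldType) (p : {poly k}) : (1 < size p)%N ->
  exists (L : fieldType) (iota : {rmorphism k -> L}) (x : L),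
    root (map_poly iota p) x.
Proof.
elim: {p}(size p) {-2}p (leqnn (size p)) => [|n IHn] p le_p_n gt1_p.
  by have := leq_trans gt1_p le_p_n.
have p0 : p != 0 by rewrite -size_poly_gt0 ltnW.
(* A root is adjoined to an irreducible factor, reached by descent on the degree. *)
have [irr_p | red_p] := classic (irreducible_poly p).
  have [L _ [x px _]] := irredp_FAdjoin irr_p.
  by exists L, (in_alg L), x.
have [q [q1 qp nqp]] : exists q : {poly k}, [/\ size q != 1, q %| p & ~~ (q %= p)].
  apply: NNPP => nex; case: red_p; split=> // q q1 qp.
  by apply: contra_notT nex => nqp; exists q.
have q0 : q != 0 by apply: contraNneq p0 => q0; rewrite q0 dvd0p in qp.
have gt1_q : (1 < size q)%N by rewrite ltn_neqAle eq_sym q1 size_poly_gt0.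
have lt_qp : (size q < size p)%N.
  by rewrite ltn_neqAle dvdp_leq // andbT dvdp_size_eqp.
have [|L [iota [x qx]]] := IHn q _ gt1_q; first by rewrite -ltnS (leq_trans lt_qp).
exists L, iota, x; have /dvdpP[r ->] := qp.
by rewrite rmorphM rootM qx orbT.
Qed.

Lemma ext_pchar0 (k L : fieldType) (iota : {rmorphism k -> L}) :
  [pchar k] =i pred0 -> [pchar L] =i pred0.
Proof. by move=> char0 p; rewrite (fmorph_pchar iota). Qed.

Definition qform (R : pzRingType) (c : R * R * R) (y0 y1 : R) :=
  c.1.1 * y0 ^+ 2 + c.1.2 * y0 * y1 + c.2 * y1 ^+ 2.

Lemma qform_scale (R : comPzRingType) (r : R) (c : R * R * R) (y0 y1 : R) :
  qform (r * c.1.1, r * c.1.2, r * c.2) y0 y1 = r * qform c y0 y1.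
Proof. by rewrite /qform /=; ring. Qed.

(** A point of a fibre in the model z^2 = Q(y0, y1). The value z = 0 is allowed; for a form [Q] over
    a field, (y0, y1) = (0, 0) would force z = 0 as well and is excluded. *)
Definition has_point (R : nzRingType) (Q : R -> R -> R) :=
  exists y0 y1 z, (y0 != 0) || (y1 != 0) /\ z ^+ 2 = Q y0 y1.

(** * Genus 1 curves over the conic v^2 = q, with q = y0^2 - d y1^2 *)

Section Core.
Variables (k : fieldType) (d : k).
Hypothesis char0 : [pchar k] =i pred0.
Hypothesis dn0 : d != 0.
Let nz n : n.+1%:R != 0 :> k := pchar0_natr_neq0 char0 n.

(* [s |-> (s^2 + d, 2s)] parametrizes [y0^2 - d y1^2 = (s^2 - d)^2]. *)
Definition proot : {poly k} := 'X^2 - d%:P.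
Definition pform (c : k * k * k) : {poly k} :=
  qform (c.1.1%:P, c.1.2%:P, c.2%:P) ('X^2 + d%:P) ('X *+ 2).
Definition pval (c : k * k * k) (s : k) := qform c (s ^+ 2 + d) (s *+ 2).

Lemma proot_neq0 : proot != 0.
Proof. by rewrite -size_poly_gt0 size_XnsubC. Qed.

Lemma horner_proot s : proot.[s] = s ^+ 2 - d.
Proof. by rewrite !hornerE. Qed.

Lemma horner_pform c s : (pform c).[s] = pval c s.
Proof.
by rewrite /pform /pval /qform !(hornerD, hornerMn, hornerM, horner_exp, hornerX, hornerC).
Qed.

(** The values at s = 0, 1, -1 and 2 suffice to kill the three coefficients. *)
Lemma pform_eq0 c0 c1 c2 : pform (c0, c1, c2) = 0 -> [/\ c0 = 0, c1 = 0 & c2 = 0].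
Proof.
move=> f0.
have fs0 s : pval (c0, c1, c2) s = 0 by rewrite -horner_pform f0 horner0.
have c0z : c0 = 0.
  have /eqP := fs0 0; rewrite (_ : pval _ _ = c0 * d ^+ 2); last by rewrite /pval /qform /=; ring.
  by rewrite mulf_eq0 expf_eq0 (negPf dn0) orbF => /eqP.
have c2z : c2 = 0.
  have : pval (c0, c1, c2) 1 + pval (c0, c1, c2) (-1) = 0 by rewrite !fs0 addr0.
  rewrite c0z (_ : _ + _ = 8%:R * c2); last by rewrite /pval /qform /=; ring.
  by move/eqP; rewrite mulf_eq0 (negPf (nz _)) => /eqP.
split=> //; apply/eqP; apply: contraTT isT => c1n.
have h s : s != 0 -> s ^+ 2 + d = 0.
  move=> sn0; have /eqP := fs0 s; rewrite c0z c2z.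
  rewrite (_ : pval _ _ = c1 * (2%:R * s) * (s ^+ 2 + d)); last by rewrite /pval /qform /=; ring.
  by rewrite !mulf_eq0 (negPf c1n) (negPf sn0) (negPf (nz 1)) => /eqP.
have : (2%:R ^+ 2 + d) - (1 ^+ 2 + d) = 0 :> k.
  by rewrite !h ?subrr ?oner_eq0 ?nz.
rewrite (_ : _ - _ = 3%:R); last by ring.
by move/eqP; rewrite (negPf (nz _)).
Qed.

(** At a root s of [proot], (s^2 + d : 2 s) = (s : 1) is a geometric zero of q, and a form vanishing
    at both zeros of q is a multiple of q. Arguing with roots in an extension treats square and
    nonsquare [d] alike. *)
Lemma pform_dvd c0 c1 c2 n H :
  pform (c0, c1, c2) ^+ n = proot * H -> c1 = 0 /\ c2 = - (d * c0).
Proof.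
move=> E.
have := @root_in_extension k proot.
rewrite size_XnsubC // => /(_ isT)[L [iota [r]]].
rewrite rmorphB /= map_polyC map_polyXn rootE !hornerE subr_eq0 => /eqP rd.
have char0L := ext_pchar0 iota char0.
have nzL n' : n'.+1%:R != 0 :> L := pchar0_natr_neq0 char0L n'.
have dL : iota d != 0 by rewrite fmorph_eq0.
have ev x : x ^+ 2 = iota d -> iota (d * c0 + c2) + iota c1 * x = 0.
  move=> xd.
  have : (map_poly iota (pform (c0, c1, c2))).[x] ^+ n = 0.
    rewrite -horner_exp -rmorphXn /= E rmorphM hornerM rmorphB /=.
    by rewrite map_polyC map_polyXn !hornerE xd subrr mul0r.
  move/eqP; rewrite expf_eq0 => /andP[_ /eqP].
  rewrite /pform /qform !(rmorphXn, rmorphM, rmorphMn, rmorphD) /=.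
  rewrite !(map_polyC, map_polyX, map_polyXn) /=.
  rewrite !(hornerD, hornerMn, hornerM, horner_exp, hornerX, hornerC, hornerXn) => e0.
  have : 4%:R * iota d * (iota (d * c0 + c2) + iota c1 * x) = 0.
    by rewrite -e0 !rmorphD !rmorphM /= -xd; ring.
  move/eqP; rewrite !mulf_eq0 (negPf dL) (negPf (nzL 3)) => /eqP.
  by rewrite rmorphD rmorphM.
have h1 := ev _ rd; have h2 : iota (d * c0 + c2) - iota c1 * r = 0.
  by rewrite -mulrN ev // sqrrN.
have c1z : c1 = 0.
  have : 2%:R * r * iota c1 = 0 by rewrite -(subrr 0) -{1}h1 -h2; ring.
  have rn0 : r != 0 by apply: contraNneq dL => r0; rewrite -rd r0 expr0n.
  by move/eqP; rewrite !mulf_eq0 (negPf rn0) (negPf (nzL 1)) fmorph_eq0 => /eqP.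
split=> //; apply/eqP; rewrite -subr_eq0 opprK addrC -(fmorph_eq0 iota).
by rewrite -h1 c1z rmorph0 mul0r addr0.
Qed.

Lemma quartic_residual_point (u l a b c : k) :
  let D := 8%:R * u ^+ 2 * (l * (4%:R * u ^+ 2 * a - l ^+ 2) - 8%:R * u ^+ 4 * b) in
  let t := (64%:R * u ^+ 6 * c - (4%:R * u ^+ 2 * a - l ^+ 2) ^+ 2) / D in
  D != 0 -> exists z, z ^+ 2 = u ^+ 2 * t ^+ 4 + l * t ^+ 3 + a * t ^+ 2 + b * t + c.
Proof.
move=> D t Dn0.
have un0 : u != 0 by apply: contraNneq Dn0 => u0; rewrite /D u0 expr0n /= mulr0 mul0r.
have Fn0 : l * (4%:R * u ^+ 2 * a - l ^+ 2) - 8%:R * u ^+ 4 * b != 0.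
  by apply: contraNneq Dn0 => F0; rewrite /D F0 mulr0.
(* The square of this expression matches the quartic in t^4, t^3 and t^2, which leaves a linear
   equation for t. *)
exists (u * t ^+ 2 + l / (2%:R * u) * t + (4%:R * u ^+ 2 * a - l ^+ 2) / (8%:R * u ^+ 3)).
rewrite /t /D; field.
by rewrite un0 Fn0 ?(nz).
Qed.

Definition fibre (l a b c : k * k * k) (t y0 y1 : k) :=
  (y0 ^+ 2 - d * y1 ^+ 2) * t ^+ 4 + qform l y0 y1 * t ^+ 3 + qform a y0 y1 * t ^+ 2
  + qform b y0 y1 * t + qform c y0 y1.

Lemma param_neq0 s : (s ^+ 2 + d != 0) || (s *+ 2 != 0).
Proof.
have [->|sn0] := eqVneq s 0; first by rewrite expr0n add0r dn0.
by rewrite -mulr_natl mulf_neq0 ?orbT.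
Qed.

Lemma param_norm s : (s ^+ 2 + d) ^+ 2 - d * (s *+ 2) ^+ 2 = (s ^+ 2 - d) ^+ 2.
Proof. ring. Qed.

(* The point of the curve over [(s^2 + d : 2 s)] residual to twice one point at
   infinity; it moves because the bisection [t = oo] ramifies at a point where
   [l] does not vanish. *)
Lemma infinite_fibre_nonproportional (l a b c : k * k * k) :
  ~ (l.1.2 = 0 /\ l.2 = - (d * l.1.1)) ->
  infinite (fun t => has_point (fibre l a b c t)).
Proof.
case: l => -[l0 l1] l2 /= lq; pose l := (l0, l1, l2).
pose F := pform l * (4%:R * proot ^+ 2 * pform a - pform l ^+ 2) - 8%:R * proot ^+ 4 * pform b.
pose D := 8%:R * proot ^+ 2 * F.
pose N := 64%:R * proot ^+ 6 * pform c - (4%:R * proot ^+ 2 * pform a - pform l ^+ 2) ^+ 2.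
have F0 : F != 0.
  apply/eqP => F0; apply: lq.
  (* Modulo [proot], [F] is - (pform l)^3. *)
  apply: (@pform_dvd _ _ _ 3 (4%:R * proot * pform a * pform l - 8%:R * proot ^+ 3 * pform b)).
  by rewrite -[LHS]addr0 -F0 /F; ring.
have D0 : D != 0.
  rewrite /D ?(mulf_neq0, expf_neq0) ?proot_neq0 //.
  by rewrite -polyC_natr polyC_eq0 nz.
have iP := infinite_nonroot (infinite_pchar0 char0) D0.
pose g s := N.[s] / D.[s].
have H : infinite (fun t => exists2 s, True /\ D.[s] != 0 & g s = t).
  apply: (infinite_rational_image (N := N) (D := D) iP) => [s [_ Ds]|t]; first by rewrite /g divfK.
  apply/eqP => ND; apply: lq.
  (* Modulo [proot], [N] is - (pform l)^4 and [D] is 0, so N = t D would make [l] a multiple of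
     q. *)
  apply: (@pform_dvd _ _ _ 4 (64%:R * proot ^+ 5 * pform c - 16%:R * proot ^+ 3 * pform a ^+ 2
     + 8%:R * proot * pform a * pform l ^+ 2 - t *: (8%:R * proot * F))).
  by rewrite -[LHS]addr0 -ND /N /D -!mul_polyC; ring.
apply: infinite_sub H => _ [s [_ Ds] <-].
have DE : D.[s] = 8%:R * (s ^+ 2
  - d) ^+ 2 * (pval l s * (4%:R * (s ^+ 2 - d) ^+ 2 * pval a s - pval l s ^+ 2)
  - 8%:R * (s ^+ 2 - d) ^+ 4 * pval b s).
  rewrite /D /F -!horner_pform -!horner_proot -!polyC_natr.
  by rewrite !(hornerM, hornerD, hornerN, horner_exp, hornerC).
have NE : N.[s] = 64%:R * (s ^+ 2 - d) ^+ 6 * pval c s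
  - (4%:R * (s ^+ 2 - d) ^+ 2 * pval a s - pval l s ^+ 2) ^+ 2.
  rewrite /N -!horner_pform -!horner_proot -!polyC_natr.
  by rewrite !(hornerM, hornerD, hornerN, horner_exp, hornerC).
rewrite DE in Ds; have [z zE] := @quartic_residual_point _ _ _ _ (pval c s) Ds.
exists (s ^+ 2 + d), (s *+ 2), z; split; first exact: param_neq0.
by rewrite zE /fibre param_norm /g NE DE.
Qed.

(** First [proot] divides the square of [pform a], so a = a0 q; cancelling then gives c = (a0^2 / 4)
    q. Hence q t^4 + a t^2 + c = q (t^2 + a0 / 2)^2. *)
Lemma pform_discriminant_eq0 (a c : k * k * k) :
  pform a ^+ 2 - 4%:R * proot ^+ 2 * pform c = 0 ->
  a = (a.1.1, 0, - (d * a.1.1)) /\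
  c = (a.1.1 ^+ 2 / 4%:R, 0, - (d * (a.1.1 ^+ 2 / 4%:R))).
Proof.
case: a c => -[a0 a1] a2 [[c0 c1] c2] /= D0.
have [a1z a2E] : a1 = 0 /\ a2 = - (d * a0).
  apply: (@pform_dvd _ _ _ 2 (4%:R * proot * pform (c0, c1, c2))).
  by rewrite -[LHS]subr0 -D0; ring.
have fpaE : pform (a0, a1, a2) = a0%:P * proot ^+ 2.
  rewrite a1z a2E /pform /qform /proot /= polyCN polyCM; ring.
have h4 : (a0 ^+ 2 / 4%:R)%:P * 4%:R = a0%:P ^+ 2 :> {poly k}.
  by rewrite -polyC_natr -polyCM divfK ?nz // polyC_exp.
split; first by rewrite a1z a2E.
have : 4%:R * proot ^+ 2 * pform (a0 ^+ 2 / 4%:R - c0, - c1, - (d * (a0 ^+ 2 / 4%:R)) - c2) = 0.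
  have -> : pform (a0 ^+ 2 / 4%:R - c0, - c1, - (d * (a0 ^+ 2 / 4%:R)) - c2)
      = (a0 ^+ 2 / 4%:R)%:P * proot ^+ 2 - pform (c0, c1, c2).
    rewrite /pform /qform /proot /= !(polyCB, polyCN, polyCM); ring.
  rewrite -D0 fpaE.
  transitivity ((a0 ^+ 2 / 4%:R)%:P * 4%:R * (proot ^+ 2) ^+ 2
    - 4%:R * proot ^+ 2 * pform (c0, c1, c2)).
    by ring.
  rewrite h4; ring.
move/eqP; rewrite mulf_eq0 => /orP[|/eqP /pform_eq0[]].
  by rewrite ?(mulf_eq0, expf_eq0) /= (negPf proot_neq0) -polyC_natr polyC_eq0 (negPf (nz _)).
by move=> /subr0_eq <- /eqP; rewrite oppr_eq0 => /eqP-> /subr0_eq <-.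
Qed.

(** Excludes a pencil whose members are all proportional to the single form q. *)
Definition neg_norm_multiple (f : k -> k -> k -> k) :=
  ~ exists g, forall t y0 y1, f t y0 y1 = (y0 ^+ 2 - d * y1 ^+ 2) * g t.

(** With l = 0 the residual point has t = (a^2 - 4 q c) / (4 q b) on the conic. If this is a
    constant t0, the pencil equals q (t^2 + a0 / 2)^2 + b (t - t0), so its member at t0 is a square
    times q and can be moved to infinity. *)
Lemma infinite_fibre_linear (a b c : k * k * k) :
  b != 0 -> neg_norm_multiple (fibre 0 a b c) ->
  (forall t, exists y0 y1, fibre 0 a b c t y0 y1 != 0) ->
  infinite (fun t => has_point (fibre 0 a b c t)).
Proof.
move=> bn0 N1 N2.
pose N := pform a ^+ 2 - 4%:R * proot ^+ 2 * pform c.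
pose D := 4%:R * proot ^+ 2 * pform b.
have fpb0 : pform b != 0.
  apply: contraNneq bn0; case: b {N1 N2 D} => -[b0 b1] b2 /pform_eq0[-> -> ->] //.
have D0 : D != 0.
  by rewrite /D ?(mulf_neq0, expf_neq0) ?proot_neq0 // -polyC_natr polyC_eq0 nz.
have iP := infinite_nonroot (infinite_pchar0 char0) D0.
pose g s := N.[s] / D.[s].
have gP s : D.[s] != 0 -> has_point (fibre 0 a b c (g s)).
  have -> : D.[s] = 4%:R * (s ^+ 2 - d) ^+ 2 * pval b s.
    rewrite /D -!horner_pform -!horner_proot -!polyC_natr.
    by rewrite !(hornerM, hornerD, hornerN, horner_exp, hornerC).
  move=> Ds.
  have un0 : s ^+ 2 - d != 0.
    by apply: contraNneq Ds => u0; rewrite u0 expr0n /= mulr0 mul0r.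
  have bs0 : pval b s != 0 by apply: contraNneq Ds => u0; rewrite u0 mulr0.
  have gE : g s = (pval a s ^+ 2
    - 4%:R * (s ^+ 2 - d) ^+ 2 * pval c s) / (4%:R * (s ^+ 2 - d) ^+ 2 * pval b s).
    rewrite /g /N /D -!horner_pform -!horner_proot -!polyC_natr.
    by rewrite !(hornerM, hornerD, hornerN, horner_exp, hornerC).
  exists (s ^+ 2 + d), (s *+ 2), ((s ^+ 2 - d) * g s ^+ 2 + pval a s / (2%:R * (s ^+ 2 - d))).
  split; first exact: param_neq0.
  rewrite /fibre param_norm -/(pval a s) -/(pval b s) -/(pval c s) gE.
  have -> : qform 0 (s ^+ 2 + d) (s *+ 2) = 0 by rewrite /qform /= !mul0r !addr0.
  move: (s ^+ 2 - d) un0 (pval a s) (pval b s) bs0 (pval c s) => u un0 a' b' bs0 c'.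
  by field; rewrite un0 bs0 !nz.
(* If the residual value is a constant [t0], recentre the pencil at [t0]. *)
have [[t0 Nt]|nN] := classic (exists t, N - t *: D = 0); last first.
  have H : infinite (fun t => exists2 s, True /\ D.[s] != 0 & g s = t).
    apply: (infinite_rational_image (N := N) (D := D) iP) => [s [_ Ds]|t];
      first by rewrite /g divfK.
    by apply/eqP => ND; apply: nN; exists t.
  by apply: infinite_sub H => _ [s [_ Ds] <-]; apply: gP.
case: a @N {gP g iP} Nt N1 N2 => -[a0 a1] a2 N Nt N1 N2.
case: b bn0 fpb0 @D D0 Nt N1 N2 => -[b0 b1] b2 bn0 fpb0 D D0 Nt N1 N2.
case: c @N Nt N1 N2 => -[c0 c1] c2 N Nt N1 N2.
have [|[a1z a2E] [c0E c1E c2E]] := @pform_discriminant_eq0 (a0, a1, a2)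
    (c0 + t0 * b0, c1 + t0 * b1, c2 + t0 * b2).
  rewrite -Nt /N /D -mul_polyC /pform /qform /= !(polyCD, polyCM); ring.
move: c0E c1E c2E => /(canRL (addrK _)) c0E /(canRL (addrK _)) c1E /(canRL (addrK _)) c2E.
have fE t y0 y1 : fibre 0 (a0, a1, a2) (b0, b1, b2) (c0, c1, c2) t y0 y1 =
  (y0 ^+ 2 - d * y1 ^+ 2) * (t ^+ 2 + a0 / 2%:R) ^+ 2 + qform (b0, b1, b2) y0 y1 * (t - t0).
  by rewrite /fibre /qform /= a1z a2E c0E c1E c2E; field; rewrite ?nz.
pose om := t0 ^+ 2 + a0 / 2%:R.
have omn0 : om != 0.
  have [y0 [y1]] := N2 t0; rewrite fE subrr mulr0 addr0 -/om.
  by apply: contraNneq => ->; rewrite expr0n mulr0.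
(* In powers of s, s^4 F(t0 + 1/s) / om^2 has leading form q and cubic coefficient [l']; the lower
   coefficients are the multiples [qm] of q. *)
pose l' := ((b0 + 4%:R * t0 * om) / om ^+ 2, b1 / om ^+ 2, (b2 - 4%:R * d * t0 * om) / om ^+ 2).
pose qm r : k * k * k := (r / om ^+ 2, 0, - (d * (r / om ^+ 2))).
have lq : ~ (l'.1.2 = 0 /\ l'.2 = - (d * l'.1.1)).
  rewrite /l' /= => -[/eqP + h2].
  rewrite mulf_eq0 invr_eq0 expf_eq0 (negPf omn0) andbF orbF => /eqP b1z.
  have b2E : b2 = - (d * b0).
    have /eqP : b2 / om ^+ 2 = - (d * b0) / om ^+ 2.
      transitivity ((b2 - 4%:R * d * t0 * om) / om ^+ 2 + 4%:R * d * t0 / om); first by field.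
      by rewrite h2; field.
    by rewrite (inj_eq (mulIf _)) ?invr_neq0 ?expf_neq0 // => /eqP.
  apply: N1; exists (fun t => (t ^+ 2 + a0 / 2%:R) ^+ 2 + b0 * (t - t0)) => t y0 y1.
  by rewrite fE /qform /= b1z b2E; ring.
(* The value s = 0 corresponds to t = oo and is discarded. *)
have iS := infinite_avoid [:: 0] (@infinite_fibre_nonproportional l'
  (qm (4%:R * t0 ^+ 2 + 2%:R * om)) (qm (4%:R * t0)) (qm 1) lq).
apply: infinite_sub (infinite_image (g := fun s => t0 + s^-1) iS _); last first.
  by move=> t; exists [:: (t - t0)^-1] => s _ <-; rewrite inE addrC addKr invrK.
move=> t [s [[y0 [y1 [z [yn0 zE]]]]]]; rewrite inE => sn0 <-.
exists y0, y1, (z * om / s ^+ 2); split=> //.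
rewrite fE !exprMn exprVn zE /fibre /qm /l' /qform /=.
have -> : a0 / 2%:R = om - t0 ^+ 2 by rewrite /om; ring.
by field; rewrite sn0 omn0.
Qed.

Lemma infinite_fibre_even (a c : k * k * k) :
  neg_norm_multiple (fibre 0 a 0 c) -> c != 0 ->
  infinite (fun t => has_point (fibre 0 a 0 c t)).
Proof.
(* [dual u] is the derivative of [u] along the norm conic: unless [a] and [c] are
   both multiples of the norm form, some base point makes it nonzero for one of them. *)
pose dual (u : k * k * k) := (u.1.2, 2%:R * (d * u.1.1 + u.2), d * u.1.2).
have fpn0 u : u != 0 -> pform u != 0.
  by apply: contraNneq; case: u => -[u0 u1] u2 /pform_eq0[-> -> ->].
have dual0 u : dual u = 0 -> u.1.2 = 0 /\ u.2 = - (d * u.1.1).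
  case: u => -[u0 u1] u2 [-> /eqP + _] /=; rewrite mulf_eq0 (negPf (nz 1)) /=.
  by rewrite addrC addr_eq0 => /eqP.
move=> N1 cn0.
have disc0 : pform a ^+ 2 - 4%:R * proot ^+ 2 * pform c != 0.
  apply/eqP => D0; apply: N1.
  have [-> ->] := pform_discriminant_eq0 D0; exists (fun t => (t ^+ 2 + a.1.1 / 2%:R) ^+ 2) =>
    t y0 y1.
  by rewrite /fibre /qform /=; field; rewrite ?nz.
have [s [un0 cs0 ds0 dual_s]] : exists s, [/\ s ^+ 2 - d != 0, pval c s != 0,
    pval a s ^+ 2 - 4%:R * (s ^+ 2 - d) ^+ 2 * pval c s != 0
    & (pval (dual a) s != 0) || (pval (dual c) s != 0)].
  have [r [rn0 rP]] : exists r, r != 0 /\ (forall s, r.[s] != 0 ->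
      (pval (dual a) s != 0) || (pval (dual c) s != 0)).
    have [da0|da0] := eqVneq (dual a) 0; last first.
      by exists (pform (dual a)); split=> [|s]; [exact: fpn0 | rewrite horner_pform => ->].
    have [dc0|dc0] := eqVneq (dual c) 0; last first.
      by exists (pform (dual c)); split=> [|s];
        [exact: fpn0 | rewrite horner_pform => ->; rewrite orbT].
    case: N1; exists (fun t => t ^+ 4 + a.1.1 * t ^+ 2 + c.1.1) => t y0 y1.
    have [a1 a2] := dual0 _ da0; have [c1 c2] := dual0 _ dc0.
    by rewrite /fibre /qform a1 a2 c1 c2 /=; ring.
  have p0 : proot * pform c * (pform a ^+ 2 - 4%:R * proot ^+ 2 * pform c) * r != 0.
    by rewrite ?mulf_neq0 ?proot_neq0 ?fpn0.
  have [s [_]] := infinite_nonroot (infinite_pchar0 char0) p0 [::].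
  rewrite -!polyC_natr !(horner_proot, horner_pform, hornerM, hornerD, hornerN, horner_exp,
    hornerC).
  rewrite !mulf_eq0 !negb_or => /andP[/andP[/andP[us cs] ds] rs] _.
  by exists s; split=> //; apply: rP.
rewrite /pval in cs0 ds0 dual_s.
move: (s ^+ 2 + d) (s *+ 2) (s ^+ 2 - d) un0 (param_norm s) cs0 ds0 dual_s.
move=> Y0 Y1 v un0 Yv cs0 ds0 dual_s.
(* Multiplication by (Y0 + Y1 sqrt d) / v has norm 1: it preserves q and moves (1 : 0) to (Y0 : Y1).
   The arguments of [H] are the coefficients of a and c in the new coordinates. *)
pose A2 := qform a (d * Y1) Y0 / v ^+ 2; pose C2 := qform c (d * Y1) Y0 / v ^+ 2.
have H := @infinite_osculating_residuals k d (qform a Y0 Y1 / v ^+ 2)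
  (qform (dual a) Y0 Y1 / v ^+ 2) A2
  (qform c Y0 Y1 / v ^+ 2) (qform (dual c) Y0 Y1 / v ^+ 2) C2 char0 dn0.
apply: infinite_sub (H _ _ _) => [t [y0 [y1 [z [yn0 zE]]]]|||].
- exists ((y0 * Y0 + y1 * (d * Y1)) / v), ((y0 * Y1 + y1 * Y0) / v), z; split.
    apply: contraNT yn0; rewrite negb_or !negbK => /andP[/eqP h0 /eqP h1].
    have : y1 * v = 0.
      transitivity (y1 * v ^+ 2 / v); first by field.
      rewrite -Yv; transitivity (Y0 * ((y0 * Y1 + y1 * Y0) / v)
        - Y1 * ((y0 * Y0 + y1 * (d * Y1)) / v)); first by field.
      by rewrite h0 h1; ring.
    by move/eqP; rewrite mulf_eq0 (negPf un0) orbF.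
  rewrite zE /fibre /A2 /C2 /dual /qform /=.
  have -> : y0 ^+ 2 - d * y1 ^+ 2 =
    ((y0 * Y0 + y1 * (d * Y1)) / v) ^+ 2 - d * ((y0 * Y1 + y1 * Y0) / v) ^+ 2.
    transitivity ((y0 ^+ 2 - d * y1 ^+ 2) * v ^+ 2 / v ^+ 2); first by field.
    by rewrite -{1}Yv; field.
  by field.
- by rewrite mulf_neq0 ?invr_neq0 ?expf_neq0.
- apply: contraNneq ds0 => h.
  have -> : qform a Y0 Y1 ^+ 2 = (qform a Y0 Y1 / v ^+ 2) ^+ 2 * v ^+ 4 by field.
  by rewrite h; apply/eqP; field.
- by rewrite !mulf_eq0 !invr_eq0 !expf_eq0 (negPf un0) !orbF.
Qed.

(** If l is a multiple of q, shifting t by a quarter of the factor removes the cubic term and the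
    linear and even cases apply. *)
Theorem infinite_fibre (l a b c : k * k * k) :
  neg_norm_multiple (fibre l a b c) ->
  (forall t, exists y0 y1, fibre l a b c t y0 y1 != 0) ->
  infinite (fun t => has_point (fibre l a b c t)).
Proof.
move=> N1 N2.
have [[l1 l2]|] := classic (l.1.2 = 0 /\ l.2 = - (d * l.1.1)); last first.
  exact: infinite_fibre_nonproportional.
pose h := l.1.1 / 4%:R.
pose a' := (a.1.1 - 6%:R * h ^+ 2, a.1.2, a.2 + 6%:R * h ^+ 2 * d).
pose b' := (b.1.1 - 2%:R * h * a.1.1 + 8%:R * h ^+ 3, b.1.2 - 2%:R * h * a.1.2,
  b.2 - 2%:R * h * a.2 - 8%:R * h ^+ 3 * d).
pose c' := (c.1.1 - h * b.1.1 + h ^+ 2 * a.1.1 - 3%:R * h ^+ 4, c.1.2 - h * b.1.2 + h ^+ 2 * a.1.2,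
  c.2 - h * b.2 + h ^+ 2 * a.2 + 3%:R * h ^+ 4 * d).
have fE t y0 y1 : fibre 0 a' b' c' t y0 y1 = fibre l a b c (t - h) y0 y1.
  have lE : l.1.1 = 4%:R * h by rewrite /h mulrC divfK ?nz.
  rewrite /fibre /qform /= l1 l2 lE; ring.
have N1' : neg_norm_multiple (fibre 0 a' b' c').
  case=> g gE; apply: N1; exists (fun t => g (t + h)) => t y0 y1.
  by rewrite -gE fE addrK.
have N2' t : exists y0 y1, fibre 0 a' b' c' t y0 y1 != 0.
  by have [y0 [y1 f0]] := N2 (t - h); exists y0, y1; rewrite fE.
have H : infinite (fun t => has_point (fibre 0 a' b' c' t)).
  have [b0|] := eqVneq b' 0; last by move=> b0; apply: infinite_fibre_linear.
  rewrite b0 in N1' N2' *; apply: infinite_fibre_even => //.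
  have [y0 [y1]] := N2' 0; apply: contraNneq => ->; apply/eqP.
  by rewrite /fibre /qform /=; ring.
apply: infinite_sub (infinite_image (g := fun t => t - h) H _) =>
  [_ [t [y0 [y1 [z [yn0 zE]]]] <-]|t].
  by exists y0, y1, z; rewrite -fE.
by exists [:: t + h] => s _ <-; rewrite inE subrK.
Qed.
End Core.

(** * Evaluation and derivatives of the conic bundle equation *)

Lemma mpoly_ring_ind n (R : comNzRingType) (P : {mpoly R[n]} -> Prop) :
  (forall c, P c%:MP) -> (forall i, P 'X_i) ->
  (forall p q, P p -> P q -> P (p + q)) -> (forall p q, P p -> P q -> P (p * q)) ->
  forall p, P p.
Proof.
move=> PC PX PD PM p; rewrite [p]mpolyE; apply: big_ind => //.
  by rewrite -mpolyC0; apply: (PC).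
move=> m _; rewrite -mul_mpolyC; apply: (PM) => //.
rewrite mpolyXE_id; apply: big_ind => [|q r|i _];
  [by rewrite -mpolyC1; apply: (PC) | exact: (PM) |].
elim: (m i) => [|j IHj]; first by rewrite expr0 -mpolyC1; apply: (PC).
by rewrite exprS; apply: (PM).
Qed.

Lemma eval_comp_mpoly n m (k L : comNzRingType) (iota : {rmorphism k -> L}) (v : 'I_m -> L)
    (lq : n.-tuple {mpoly k[m]}) (p : {mpoly k[n]}) :
  (map_mpoly iota (p \mPo lq)).@[v] =
    (map_mpoly iota p).@[fun i => (map_mpoly iota (tnth lq i)).@[v]].
Proof.
elim/mpoly_ring_ind: p => [c|i|p q IHp IHq|p q IHp IHq].
- by rewrite comp_mpolyC !map_mpolyC !mevalC.
- by rewrite comp_mpolyXU map_mpolyX mevalXU -tnth_nth.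
- by rewrite !rmorphD /= IHp IHq.
- by rewrite !rmorphM /= IHp IHq.
Qed.

Lemma mderivXU n (R : comNzRingType) (i j : 'I_n) : ('X_i : {mpoly R[n]})^`M(j) = (i == j)%:R.
Proof.
rewrite mderivX mnm1E; case: eqVneq => [->|_]; last by rewrite scale0r.
rewrite scale1r (_ : (U_(j) - U_(j) = 0)%MM) ?mpolyX0 //.
by apply/mnmP => l; rewrite mnmBE subnn mnm0E.
Qed.

Lemma mderiv_to_cox_y (k : fieldType) (p : {mpoly k[2]}) j : (to_cox p)^`M(iy j) = 0.
Proof.
rewrite /to_cox; elim/mpoly_ring_ind: p => [c|i|p q IHp IHq|p q IHp IHq].
- by rewrite comp_mpolyC mderivC.
- rewrite comp_mpolyXU -tnth_nth tnth_mktuple mderivXU.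
  by rewrite eq_lrshift.
- by rewrite rmorphD /= mderivD IHp IHq addr0.
- by rewrite rmorphM /= mderivM IHp IHq mul0r mulr0 addr0.
Qed.

Lemma mderiv_to_cox_x (k : fieldType) (p : {mpoly k[2]}) i :
  (to_cox p)^`M(ix i) = to_cox (p^`M(i)).
Proof.
rewrite /to_cox; elim/mpoly_ring_ind: p => [c|j|p q IHp IHq|p q IHp IHq].
- by rewrite comp_mpolyC !mderivC rmorph0.
- rewrite comp_mpolyXU -tnth_nth tnth_mktuple !mderivXU (inj_eq (@lshift_inj _ _)).
  by rewrite rmorph_nat.
- by rewrite !rmorphD /= !mderivD IHp IHq rmorphD.
- by rewrite rmorphM /= !mderivM IHp IHq rmorphD !rmorphM.
Qed.

(* Coefficients of a binary quartic, by increasing powers of the first variable. *)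
Definition quartic (R : pzRingType) (c : nat -> R) (x0 x1 : R) :=
  c 0%N * x1 ^+ 4 + c 1%N * x0 * x1 ^+ 3 + c 2%N * x0 ^+ 2 * x1 ^+ 2 + c 3%N * x0 ^+ 3 * x1
    + c 4%N * x0 ^+ 4.

Lemma quarticP (k : fieldType) (p : {mpoly k[2]}) : p \is 4.-homog ->
  exists c : nat -> k, p = quartic (fun i => (c i)%:MP) 'X_ord0 'X_ord_max.
Proof.
move=> hp; rewrite [p]mpolyE big_seq.
apply: (big_ind (fun p => exists c : nat -> k, p =
  quartic (fun i => (c i)%:MP) 'X_ord0 'X_ord_max)).
- by exists (fun=> 0); rewrite /quartic mpolyC0 !mul0r !addr0.
- move=> _ _ [c ->] [c' ->]; exists (fun i => c i + c' i).
  by rewrite /quartic !mpolyCD; ring.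
move=> m mp; have md := dhomog_mf hp mp.
have m1 : (m ord_max = 4 - m ord0)%N.
  by rewrite -md /= mdegE big_ord_recr big_ord1 /= (_ : widen_ord _ _ = ord0) ?addKn //;
    apply: val_inj.
have m0 : (m ord0 <= 4)%N.
  by rewrite -md /= mdegE big_ord_recr big_ord1 /= (_ : widen_ord _ _ = ord0) ?leq_addr //;
    apply: val_inj.
exists (fun i => if i == m ord0 then p@_m else 0).
rewrite mpolyXE_id big_ord_recr big_ord1 /= (_ : widen_ord _ _ = ord0); last exact: val_inj.
rewrite m1 -mul_mpolyC /quartic.
by case: (m ord0) m0 => [|[|[|[|[|]]]]] //= _; rewrite mpolyC0; ring.
Qed.

(** Partial derivative of [quartic] in its first variable; [quartic_d1] is the one in the second. *)
Definition quartic_d0 (R : pzRingType) (c : nat -> R) (x0 x1 : R) :=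
  c 1%N * x1 ^+ 3 + 2%:R * c 2%N * x0 * x1 ^+ 2 + 3%:R * c 3%N * x0 ^+ 2 * x1
    + 4%:R * c 4%N * x0 ^+ 3.
Definition quartic_d1 (R : pzRingType) (c : nat -> R) (x0 x1 : R) :=
  4%:R * c 0%N * x1 ^+ 3 + 3%:R * c 1%N * x0 * x1 ^+ 2 + 2%:R * c 2%N * x0 ^+ 2 * x1
    + c 3%N * x0 ^+ 3.

Lemma quartic_euler (R : comPzRingType) (c : nat -> R) (x0 x1 : R) :
  x0 * quartic_d0 c x0 x1 + x1 * quartic_d1 c x0 x1 = 4%:R * quartic c x0 x1.
Proof. rewrite /quartic_d0 /quartic_d1 /quartic; ring. Qed.

Lemma quartic_scale (R : comPzRingType) (c : nat -> R) (t x0 x1 : R) :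
  quartic c (t * x0) (t * x1) = t ^+ 4 * quartic c x0 x1.
Proof. rewrite /quartic; ring. Qed.

Lemma quartic_morph (R S : comPzRingType) (f : {rmorphism R -> S}) c x0 x1 :
  f (quartic c x0 x1) = quartic (fun i => f (c i)) (f x0) (f x1).
Proof. by rewrite /quartic !(rmorphXn, rmorphM, rmorphD). Qed.

Lemma quartic_d0_morph (R S : comPzRingType) (f : {rmorphism R -> S}) c x0 x1 :
  f (quartic_d0 c x0 x1) = quartic_d0 (fun i => f (c i)) (f x0) (f x1).
Proof. by rewrite /quartic_d0 !(rmorph_nat, rmorphXn, rmorphM, rmorphD). Qed.

Lemma quartic_d1_morph (R S : comPzRingType) (f : {rmorphism R -> S}) c x0 x1 :
  f (quartic_d1 c x0 x1) = quartic_d1 (fun i => f (c i)) (f x0) (f x1).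
Proof. by rewrite /quartic_d1 !(rmorph_nat, rmorphXn, rmorphM, rmorphD). Qed.

Section Eval.
Variables (k L : fieldType) (iota : {rmorphism k -> L}).

Definition ev (x : 'I_2 -> L) (p : {mpoly k[2]}) : L := (map_mpoly iota p).@[x].

Lemma ev_quartic x c : ev x (quartic (fun i => (c i)%:MP) 'X_ord0 'X_ord_max) =
  quartic (fun i => iota (c i)) (x ord0) (x ord_max).
Proof.
rewrite /ev !quartic_morph /= !map_mpolyX !mevalXU /quartic.
by rewrite !map_mpolyC !mevalC.
Qed.

Lemma ev_quartic_mderiv i x c (p := quartic (fun i => (c i)%:MP) 'X_ord0 'X_ord_max) :
  ev x p^`M(i) = quartic_d0 (fun i => iota (c i)) (x ord0) (x ord_max) * (ord0 == i)%:R
    + quartic_d1 (fun i => iota (c i)) (x ord0) (x ord_max) * (ord_max == i)%:R.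
Proof.
have gen (c' : nat -> {mpoly k[2]}) X0 X1 : (forall j, (c' j)^`M(i) = 0) ->
    (quartic c' X0 X1)^`M(i) = quartic_d0 c' X0 X1 * X0^`M(i) + quartic_d1 c' X0 X1 * X1^`M(i).
  move=> c0; rewrite /quartic /quartic_d0 /quartic_d1 !exprS !expr0 !mulr1.
  rewrite !(mderivD, mderivM) !c0; ring.
rewrite /p gen; last by move=> j; rewrite mderivC.
rewrite !mderivXU.
have lin (q0 q1 : {mpoly k[2]}) (b0 b1 : bool) :
    ev x (q0 * b0%:R + q1 * b1%:R) = ev x q0 * b0%:R + ev x q1 * b1%:R.
  by rewrite /ev !rmorphD !rmorphM /= !rmorph_nat.
rewrite lin; congr (_ * _ + _ * _).
  rewrite /ev quartic_d0_morph /= quartic_d0_morph /= /quartic_d0.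
  by rewrite !map_mpolyX !mevalXU !map_mpolyC !mevalC.
rewrite /ev quartic_d1_morph /= quartic_d1_morph /= /quartic_d1.
by rewrite !map_mpolyX !mevalXU !map_mpolyC !mevalC.
Qed.

Variable v : 'I_(2 + 3) -> L.
Let x i := v (ix i).

Lemma eval_to_cox p : eval_at iota v (to_cox p) = ev x p.
Proof.
rewrite /eval_at /to_cox eval_comp_mpoly; apply: meval_eq => i.
by rewrite tnth_mktuple map_mpolyX mevalXU.
Qed.

Lemma eval_atD : {morph eval_at iota v : p q / p + q}.
Proof. by move=> p q; rewrite /eval_at !rmorphD. Qed.
Lemma eval_atM : {morph eval_at iota v : p q / p * q}.
Proof. by move=> p q; rewrite /eval_at !rmorphM. Qed.
Lemma eval_atXn n : {morph eval_at iota v : p / p ^+ n}.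
Proof. by move=> p; rewrite /eval_at !rmorphXn. Qed.
Lemma eval_atX i : eval_at iota v 'X_i = v i.
Proof. by rewrite /eval_at map_mpolyX mevalXU. Qed.
Lemma eval_atC c : eval_at iota v c%:MP = iota c.
Proof. by rewrite /eval_at map_mpolyC mevalC. Qed.
Definition eval_atE := (eval_atD, eval_atM, eval_atXn, eval_to_cox, eval_atX, eval_atC).

Variable s : conic_coeffs k.
Let Y0 := v (iy y0). Let Y1 := v (iy y1). Let Y2 := v (iy y2).

Lemma eval_conic : eval_at iota v (conic_eq s) =
  ev x (s00 s) * Y0 ^+ 2 + ev x (s01 s) * Y0 * Y1 + ev x (s02 s) * Y0 * Y2
  + ev x (s11 s) * Y1 ^+ 2 + ev x (s12 s) * Y1 * Y2 + iota (s22 s) * Y2 ^+ 2.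
Proof. by rewrite /conic_eq !eval_atE. Qed.

Let iyE (i j : 'I_3) : (iy i == iy j) = (i == j).
Proof. exact: (inj_eq (@rshift_inj _ _)). Qed.
Let ixyE i j : (iy j == ix i) = false.
Proof. exact: eq_rlshift. Qed.

(** One product rule serves all five variables: for a y the derivatives of the [to_cox] terms
    vanish, for an x those of the ['X_(iy _)]. *)
Lemma eval_conic_mderiv i :
  let D p := eval_at iota v p^`M(i) in
  D (conic_eq s) =
    D (to_cox (s00 s)) * Y0 ^+ 2 + D (to_cox (s01 s)) * Y0 * Y1 + D (to_cox (s02 s)) * Y0 * Y2
  + D (to_cox (s11 s)) * Y1 ^+ 2 + D (to_cox (s12 s)) * Y1 * Y2
  + (2%:R * ev x (s00 s) * Y0 + ev x (s01 s) * Y1 + ev x (s02 s) * Y2) * D 'X_(iy y0)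
  + (ev x (s01 s) * Y0 + 2%:R * ev x (s11 s) * Y1 + ev x (s12 s) * Y2) * D 'X_(iy y1)
  + (ev x (s02 s) * Y0 + ev x (s12 s) * Y1 + 2%:R * iota (s22 s) * Y2) * D 'X_(iy y2).
Proof.
have gen (a b c e f g X0 X1 X2 : cox_ring k) :
    (a * X0 ^+ 2 + b * X0 * X1 + c * X0 * X2 + e * X1 ^+ 2 + f * X1 * X2 + g * X2 ^+ 2)^`M(i) =
    a^`M(i) * X0 ^+ 2 + b^`M(i) * X0 * X1 + c^`M(i) * X0 * X2 + e^`M(i) * X1 ^+ 2
    + f^`M(i) * X1 * X2 + g^`M(i) * X2 ^+ 2 + (a * X0 + a * X0 + b * X1 + c * X2) * X0^`M(i)
    + (b * X0 + (e * X1 + e * X1) + f * X2) * X1^`M(i)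
      + (c * X0 + f * X1 + (g * X2 + g * X2)) * X2^`M(i).
  by rewrite !expr2 !(mderivD, mderivM); ring.
move=> D; rewrite /D /conic_eq gen mderivC mul0r addr0.
move: (_^`M(i)) (_^`M(i)) (_^`M(i)) (_^`M(i)) (_^`M(i)) (_^`M(i)) (_^`M(i)) (_^`M(i)).
move=> d1 d2 d3 d4 d5 d6 d7 d8.
rewrite !(eval_atD, eval_atM) !eval_to_cox !eval_atX eval_atC -/Y0 -/Y1 -/Y2 -/x.
move: (eval_at iota v d1) (eval_at iota v d2) (eval_at iota v d3) (eval_at iota v d4).
move: (eval_at iota v d5) (eval_at iota v d6) (eval_at iota v d7) (eval_at iota v d8).
move: Y0 Y1 Y2 (ev x _) (ev x _) (ev x _) (ev x _) (ev x _) => *; ring.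
Qed.

Let eval_at0 : eval_at iota v 0 = 0.
Proof. by rewrite /eval_at !rmorph0. Qed.
Let eval_at1 : eval_at iota v 1 = 1.
Proof. by rewrite /eval_at !rmorph1. Qed.

Lemma eval_conic_dy0 : eval_at iota v (conic_eq s)^`M(iy y0) =
  2%:R * ev x (s00 s) * Y0 + ev x (s01 s) * Y1 + ev x (s02 s) * Y2.
Proof.
rewrite eval_conic_mderiv !mderiv_to_cox_y !mderivXU !iyE /= eval_at0 eval_at1.
by rewrite !(mul0r, mulr0, add0r, addr0, mulr1).
Qed.
Lemma eval_conic_dy1 : eval_at iota v (conic_eq s)^`M(iy y1) =
  ev x (s01 s) * Y0 + 2%:R * ev x (s11 s) * Y1 + ev x (s12 s) * Y2.
Proof.
rewrite eval_conic_mderiv !mderiv_to_cox_y !mderivXU !iyE /= eval_at0 eval_at1.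
by rewrite !(mul0r, mulr0, add0r, addr0, mulr1).
Qed.
Lemma eval_conic_dy2 : eval_at iota v (conic_eq s)^`M(iy y2) =
  ev x (s02 s) * Y0 + ev x (s12 s) * Y1 + 2%:R * iota (s22 s) * Y2.
Proof.
rewrite eval_conic_mderiv !mderiv_to_cox_y !mderivXU !iyE /= eval_at0 eval_at1.
by rewrite !(mul0r, mulr0, add0r, addr0, mulr1).
Qed.
Lemma eval_conic_dx i : eval_at iota v (conic_eq s)^`M(ix i) =
  ev x (s00 s)^`M(i) * Y0 ^+ 2 + ev x (s01 s)^`M(i) * Y0 * Y1 + ev x (s02 s)^`M(i) * Y0 * Y2
  + ev x (s11 s)^`M(i) * Y1 ^+ 2 + ev x (s12 s)^`M(i) * Y1 * Y2.
Proof.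
rewrite eval_conic_mderiv !mderiv_to_cox_x !mderivXU !ixyE /= eval_at0.
by rewrite !eval_to_cox !(mulr0, addr0).
Qed.
End Eval.

Definition cox_tuple (R : nzRingType) (x : 'I_2 -> R) (a b c : R) (i : 'I_(2 + 3)) : R :=
  match split i with inl j => x j | inr j => nth 0 [:: a; b; c] j end.

Lemma cox_tuple_x (R : nzRingType) x (a b c : R) i : cox_tuple x a b c (ix i) = x i.
Proof. by rewrite /cox_tuple -[ix i]/(unsplit (inl i)) unsplitK. Qed.

Lemma cox_tuple_y (R : nzRingType) x (a b c : R) j :
  cox_tuple x a b c (iy j) = nth 0 [:: a; b; c] j.
Proof. by rewrite /cox_tuple -[iy j]/(unsplit (inr j)) unsplitK. Qed.

Lemma cox_tuple_eta (R : nzRingType) (v : 'I_(2 + 3) -> R) :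
  v =1 cox_tuple (fun i => v (ix i)) (v (iy y0)) (v (iy y1)) (v (iy y2)).
Proof.
move=> i; rewrite -[i in LHS]splitK -[i in RHS]splitK.
case: (split i) => j /=; first by rewrite cox_tuple_x.
rewrite cox_tuple_y; case: j => [[|[|[|]]] // lt3] /=; congr v;
  by apply: val_inj.
Qed.

(** Turns evaluated coefficients into atoms for [ring] and [field]. *)
Ltac gen_ev := repeat match goal with |- context [ev ?i ?x ?p] =>
  let e := fresh in move: (ev i x p) => e end.

(** * The double cover z^2 = F and its discriminant form *)

Section Discriminant.
Variables (k : fieldType) (s : conic_coeffs k).

(** The three coefficients of F, the discriminant of the equation as a quadratic polynomial in
    y2. *)
Definition disc00 : {mpoly k[2]} := s02 s ^+ 2 - (4%:R * s22 s)%:MP * s00 s.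
Definition disc01 : {mpoly k[2]} := s02 s * s12 s *+ 2 - (4%:R * s22 s)%:MP * s01 s.
Definition disc11 : {mpoly k[2]} := s12 s ^+ 2 - (4%:R * s22 s)%:MP * s11 s.

Lemma disc_homog : conic_bundle_220 s ->
  [/\ disc00 \is 4.-homog, disc01 \is 4.-homog & disc11 \is 4.-homog].
Proof.
case=> -[h00 h01 h11] [h02 h12] _ _.
have hZ (c : k) p : p \is 4.-homog -> c%:MP * p \is 4.-homog.
  by move=> hp; rewrite mul_mpolyC dhomogZ.
have hM (p q : {mpoly k[2]}) : p \is 2.-homog -> q \is 2.-homog -> p * q \is 4.-homog.
  by move=> hp hq; apply: (dhomogM hp hq).
split; rewrite /disc00 /disc01 /disc11 ?mulr2n; apply: rpredB; rewrite ?hZ //.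
- by rewrite expr2 hM.
- by apply: rpredD; rewrite hM.
- by rewrite expr2 hM.
Qed.

Variables (L : fieldType) (iota : {rmorphism k -> L}).

Definition disc_form (x : 'I_2 -> L) : L * L * L :=
  (ev iota x disc00, ev iota x disc01, ev iota x disc11).

(** The coordinate z, which is also the partial derivative of the equation in y2. *)
Definition zform (x : 'I_2 -> L) (a b c : L) :=
  ev iota x (s02 s) * a + ev iota x (s12 s) * b + 2%:R * iota (s22 s) * c.

Lemma evD x : {morph ev iota x : p q / p + q}. Proof. by move=> p q; rewrite /ev !rmorphD. Qed.
Lemma evN x : {morph ev iota x : p / - p}. Proof. by move=> p; rewrite /ev !rmorphN. Qed.
Lemma evM x : {morph ev iota x : p q / p * q}. Proof. by move=> p q; rewrite /ev !rmorphM. Qed.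
Lemma evC x c : ev iota x c%:MP = iota c. Proof. by rewrite /ev map_mpolyC mevalC. Qed.
Lemma ev_ext x x' p : x =1 x' -> ev iota x p = ev iota x' p. Proof. exact: meval_eq. Qed.

Lemma disc_formE x : disc_form x =
  (ev iota x (s02 s) ^+ 2 - 4%:R * iota (s22 s) * ev iota x (s00 s),
   2%:R * ev iota x (s02 s) * ev iota x (s12 s) - 4%:R * iota (s22 s) * ev iota x (s01 s),
   ev iota x (s12 s) ^+ 2 - 4%:R * iota (s22 s) * ev iota x (s11 s)).
Proof.
rewrite /disc_form /disc00 /disc01 /disc11 !expr2 mulr2n !(evD, evN, evM) !evC !rmorphM !rmorph_nat.
by gen_ev; congr (_, _, _); ring.
Qed.

Lemma disc_form_mderivE x i :
  (ev iota x disc00^`M(i), ev iota x disc01^`M(i), ev iota x disc11^`M(i)) =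
  (2%:R * ev iota x (s02 s) * ev iota x (s02 s)^`M(i)
    - 4%:R * iota (s22 s) * ev iota x (s00 s)^`M(i),
   2%:R * (ev iota x (s02 s)^`M(i) * ev iota x (s12 s)
     + ev iota x (s02 s) * ev iota x (s12 s)^`M(i))
     - 4%:R * iota (s22 s) * ev iota x (s01 s)^`M(i),
   2%:R * ev iota x (s12 s) * ev iota x (s12 s)^`M(i)
     - 4%:R * iota (s22 s) * ev iota x (s11 s)^`M(i)).
Proof.
rewrite /disc00 /disc01 /disc11 !expr2 mulr2n !(mderivB, mderivD, mderivM, mderivC, mul0r, add0r).
move: (s00 s)^`M(i) (s01 s)^`M(i) (s02 s)^`M(i) (s11 s)^`M(i) (s12 s)^`M(i) => d0 d1 d2 d3 d4.
rewrite !(evD, evN, evM) !evC !rmorphM !rmorph_nat.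
by gen_ev; congr (_, _, _); ring.
Qed.

Lemma complete_square x a b c :
  4%:R * iota (s22 s) * eval_at iota (cox_tuple x a b c) (conic_eq s) =
  zform x a b c ^+ 2 - qform (disc_form x) a b.
Proof.
rewrite eval_conic !cox_tuple_y /= disc_formE /qform /zform /=.
by rewrite !(ev_ext _ (cox_tuple_x x a b c)); gen_ev; ring.
Qed.

Hypothesis char0 : [pchar k] =i pred0.
Hypothesis s22n0 : s22 s != 0.
Let nzL n : n.+1%:R != 0 :> L := pchar0_natr_neq0 (ext_pchar0 iota char0) n.
Let s22L : iota (s22 s) != 0. Proof. by rewrite fmorph_eq0. Qed.

Lemma on_conicP x a b c :
  eval_at iota (cox_tuple x a b c) (conic_eq s) = 0 <-> zform x a b c ^+ 2 =
    qform (disc_form x) a b.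
Proof.
split=> [h|/eqP]; first by apply/eqP; rewrite -subr_eq0 -complete_square h mulr0.
rewrite -subr_eq0 -complete_square !mulf_eq0 (negPf (nzL 3)) (negPf s22L) => /eqP //.
Qed.

Lemma zform_surj x a b z : exists c, zform x a b c = z.
Proof.
exists ((z - ev iota x (s02 s) * a - ev iota x (s12 s) * b) / (2%:R * iota (s22 s))).
by rewrite /zform; gen_ev; field; rewrite s22L nzL.
Qed.

Definition polar0 (c : L * L * L) (a b : L) := 2%:R * c.1.1 * a + c.1.2 * b.
Definition polar1 (c : L * L * L) (a b : L) := c.1.2 * a + 2%:R * c.2 * b.

Lemma qform_polar c a b : 2%:R * qform c a b = polar0 c a b * a + polar1 c a b * b.
Proof. rewrite /qform /polar0 /polar1; ring. Qed.

(* On the ramification curve [zform = 0] the partial derivatives of the equation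
   are proportional to those of the discriminant form. *)
Lemma conic_dy_eq0 x a b c (v := cox_tuple x a b c) : zform x a b c = 0 ->
  [/\ polar0 (disc_form x) a b = - (4%:R * iota (s22 s)) * eval_at iota v (conic_eq s)^`M(iy y0),
      polar1 (disc_form x) a b = - (4%:R * iota (s22 s)) * eval_at iota v (conic_eq s)^`M(iy y1)
    & eval_at iota v (conic_eq s)^`M(iy y2) = zform x a b c].
Proof.
move=> z0; rewrite eval_conic_dy0 eval_conic_dy1 eval_conic_dy2 /v !cox_tuple_y /= disc_formE.
rewrite !(ev_ext _ (cox_tuple_x x a b c)) /polar0 /polar1 /=; split=> //.
- transitivity (- (4%:R * iota (s22 s)) * (2%:R * ev iota x (s00 s) * a + ev iota x (s01 s) * b
    + ev iota x (s02 s) * c)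
    + 2%:R * ev iota x (s02 s) * zform x a b c); last by rewrite z0 mulr0 addr0.
  by rewrite /zform; gen_ev; ring.
- transitivity (- (4%:R * iota (s22 s)) * (ev iota x (s01 s) * a + 2%:R * ev iota x (s11 s) * b
    + ev iota x (s12 s) * c)
    + 2%:R * ev iota x (s12 s) * zform x a b c); last by rewrite z0 mulr0 addr0.
  by rewrite /zform; gen_ev; ring.
Qed.

Lemma conic_dx_eq0 x a b c i (v := cox_tuple x a b c) : zform x a b c = 0 ->
  qform (ev iota x disc00^`M(i), ev iota x disc01^`M(i), ev iota x disc11^`M(i)) a b =
    - (4%:R * iota (s22 s)) * eval_at iota v (conic_eq s)^`M(ix i).
Proof.
move=> z0; rewrite eval_conic_dx /v !cox_tuple_y /= disc_form_mderivE.
rewrite !(ev_ext _ (cox_tuple_x x a b c)) /qform /=.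
(* The added last summand is the term 2 z dz from differentiating z^2; it vanishes at z = 0. *)
transitivity (- (4%:R * iota (s22 s)) * (ev iota x (s00 s)^`M(i) * a ^+ 2
  + ev iota x (s01 s)^`M(i) * a * b
    + ev iota x (s02 s)^`M(i) * a * c + ev iota x (s11 s)^`M(i) * b ^+ 2
      + ev iota x (s12 s)^`M(i) * b * c)
    + 2%:R * (ev iota x (s02 s)^`M(i) * a + ev iota x (s12 s)^`M(i) * b) * zform x a b c);
  last by rewrite z0 mulr0 addr0.
by rewrite /zform; gen_ev; ring.
Qed.
End Discriminant.

Lemma ev_comp (k L M : fieldType) (f : {rmorphism k -> L}) (g : {rmorphism L -> M}) x p :
  ev (g \o f) (fun i => g (x i)) p = g (ev f x p).
Proof.
rewrite /ev; elim/mpoly_ring_ind: p => [c|i|p q IHp IHq|p q IHp IHq].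
- by rewrite !map_mpolyC !mevalC.
- by rewrite !map_mpolyX !mevalXU.
- by rewrite !rmorphD /= IHp IHq.
- by rewrite !rmorphM /= IHp IHq.
Qed.

Lemma ev_euler (k L : fieldType) (iota : {rmorphism k -> L}) x p : p \is 4.-homog ->
  x ord0 * ev iota x p^`M(ord0) + x ord_max * ev iota x p^`M(ord_max) = 4%:R * ev iota x p.
Proof.
case/quarticP=> c ->; rewrite !ev_quartic_mderiv ev_quartic -quartic_euler /=.
by rewrite !mulr1 !mulr0 addr0 add0r.
Qed.

Lemma qform_zero_in_extension (L : fieldType) (c : L * L * L) :
  exists (M : fieldType) (g : {rmorphism L -> M}) (a b : M),
    (a != 0) || (b != 0) /\ qform (g c.1.1, g c.1.2, g c.2) a b = 0.
Proof.
case: c => -[c0 c1] c2 /=; have [->|c0n] := eqVneq c0 0.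
  exists L, idfun, 1, 0; split; first by rewrite oner_eq0.
  by rewrite /qform /= !(mul0r, mulr0, expr0n, addr0).
have sz : (1 < size (Poly [:: c2; c1; c0]))%N by rewrite (PolyK (c := 0)).
have [M [g [r]]] := root_in_extension sz; rewrite rootE => /eqP r0.
exists M, g, r, 1; split; first by rewrite oner_eq0 orbT.
rewrite -r0 /= !cons_poly_def !(rmorphD, rmorphM) /= !map_polyX !map_polyC /= rmorph0.
by rewrite !hornerE /qform /=; ring.
Qed.

Lemma ord2P (i : 'I_2) : i = ord0 \/ i = ord_max.
Proof. by case: i => [[|[|]]] // h; [left | right]; apply: val_inj. Qed.

Lemma ord3P (j : 'I_3) : j = y0 \/ j = y1 \/ j = y2.
Proof.
by case: j => [[|[|[|]]] // h]; [left | right; left | right; right]; apply: val_inj.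
Qed.

(** * Smoothness in terms of the discriminant form *)

Section Smooth.
Variables (k : fieldType) (s : conic_coeffs k).
Hypothesis char0 : [pchar k] =i pred0.
Hypothesis cb : conic_bundle_220 s.
Hypothesis smooth : smooth_total_space s.

Lemma s22_neq0 : s22 s != 0. Proof. by case: cb => _ _ []. Qed.

(** A point where all partial derivatives of F vanish is a zero of F by Euler's relation, and lifts
    with z = 0 to a singular point of the surface. *)
Lemma no_singular_point (L : fieldType) (iota : {rmorphism k -> L}) x a b :
  (exists i, x i != 0) -> (a != 0) || (b != 0) ->
  polar0 (disc_form s iota x) a b = 0 -> polar1 (disc_form s iota x) a b = 0 ->
  ~ (forall i, qform (ev iota x (disc00 s)^`M(i), ev iota x (disc01 s)^`M(i),
    ev iota x (disc11 s)^`M(i)) a b = 0).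
Proof.
move=> xn0 abn0 P0 P1 dx0.
have nzL n : n.+1%:R != 0 :> L := pchar0_natr_neq0 (ext_pchar0 iota char0) n.
have fn0 : - (4%:R * iota (s22 s)) != 0.
  by rewrite oppr_eq0 mulf_neq0 ?nzL // fmorph_eq0 s22_neq0.
have [c z0] := zform_surj iota char0 s22_neq0 x a b 0.
have q0 : qform (disc_form s iota x) a b = 0.
  have /eqP := qform_polar (disc_form s iota x) a b.
  by rewrite P0 P1 !mul0r addr0 mulf_eq0 (negPf (nzL 1)) => /eqP.
pose v := cox_tuple x a b c.
have pv : point_on s iota v.
  split; last by apply/(on_conicP iota char0 s22_neq0); rewrite z0 expr0n q0.
  split; first by have [i xi] := xn0; exists i; rewrite /v cox_tuple_x.
  by case/orP: abn0 => h; [exists y0 | exists y1]; rewrite /v cox_tuple_y.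
have [E0 E1 E2] := conic_dy_eq0 z0.
have cancel_fn0 e : 0 = - (4%:R * iota (s22 s)) * e -> e = 0.
  by move/esym/eqP; rewrite mulf_eq0 (negPf fn0) => /eqP.
have [i] := smooth pv; case/negP; apply/eqP.
rewrite -[i]splitK; case: (split i) => j /=.
  by apply: cancel_fn0; rewrite -(conic_dx_eq0 j z0) dx0.
have [->|[->|->]] := ord3P j.
- by apply: cancel_fn0; rewrite -E0 P0.
- by apply: cancel_fn0; rewrite -E1 P1.
- by rewrite E2 z0.
Qed.

Lemma disc_form_neq0 (L : fieldType) (iota : {rmorphism k -> L}) x :
  (exists i, x i != 0) -> disc_form s iota x != 0.
Proof.
(* If the form vanished at [x], Euler's relation would make its two partial
   derivatives in [x] proportional, so a zero of one of them in an extension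
   would be a singular point. *)
move=> [i0 xi0]; apply/eqP => d0.
have [hA hB hC] := disc_homog cb.
have [j ji0 euler] : exists2 j, j != i0 & forall p, p \is 4.-homog -> ev iota x p = 0 ->
    x i0 * ev iota x p^`M(i0) = - (x j * ev iota x p^`M(j)).
  have E p : p \is 4.-homog -> ev iota x p = 0 ->
      x ord0 * ev iota x p^`M(ord0) + x ord_max * ev iota x p^`M(ord_max) = 0.
    by move=> /ev_euler-> ->; rewrite mulr0.
  have [->|->] := ord2P i0; [exists ord_max => // | exists ord0 => //] => p hp p0;
    apply/eqP; rewrite -addr_eq0; first by rewrite E.
  by rewrite addrC E.
have [M [g [a [b [abn0 q0]]]]] := qform_zero_in_extension
  (ev iota x (disc00 s)^`M(j), ev iota x (disc01 s)^`M(j), ev iota x (disc11 s)^`M(j)).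
have df0 : disc_form s (g \o iota) (fun i => g (x i)) = 0.
  by move: d0; rewrite /disc_form !ev_comp => -[-> -> ->]; rewrite rmorph0.
case: (@no_singular_point M (g \o iota) (fun i => g (x i)) a b) => //.
- by exists i0; rewrite fmorph_eq0.
- by rewrite df0 /polar0 /= !(mulr0, mul0r, addr0).
- by rewrite df0 /polar1 /= !(mulr0, mul0r, addr0).
move=> i; rewrite !ev_comp.
have [->//|ij] := eqVneq i j.
have {i ij}-> : i = i0.
  by apply/eqP; move: ij ji0; have [->|->] := ord2P i; have [->|->] := ord2P j;
    have [->|->] := ord2P i0.
have gx : g (x i0) != 0 by rewrite fmorph_eq0.
(* Multiplied by x_i0, the derivative form at [i0] becomes - x_j times the one at [j], which
   vanishes at (a, b). *)
apply: (mulfI gx); rewrite mulr0.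
move: d0; rewrite /disc_form => -[A0 B0 C0].
have := (euler _ hA A0, euler _ hB B0, euler _ hC C0) => -[[EA EB] EC].
transitivity (- g (x j) * qform (g (ev iota x (disc00 s)^`M(j)), g (ev iota x (disc01 s)^`M(j)),
  g (ev iota x (disc11 s)^`M(j))) a b).
  move: EA EB EC; rewrite /qform /=; gen_ev => EA EB EC.
  move/(congr1 g): EA; move/(congr1 g): EB; move/(congr1 g): EC.
  rewrite !rmorphN ![g (_ * _)]rmorphM => EC EB EA.
  rewrite !mulrDr !mulrA EA EB EC; ring.
by rewrite q0 mulr0.
Qed.
End Smooth.

(** * Conics z^2 = c(y0, y1) for a binary quadratic form c *)

Definition qdisc (R : pzRingType) (c : R * R * R) := c.1.2 ^+ 2 - 4%:R * c.1.1 * c.2.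

Lemma qdisc_scale (R : comPzRingType) (r : R) (c : R * R * R) :
  qdisc (r * c.1.1, r * c.1.2, r * c.2) = r ^+ 2 * qdisc c.
Proof. by rewrite /qdisc /=; ring. Qed.

Section Conic.
Variable k : fieldType.
Hypothesis char0 : [pchar k] =i pred0.
Let nz n : n.+1%:R != 0 :> k := pchar0_natr_neq0 char0 n.

Lemma degenerate_kernel (c : k * k * k) : qdisc c = 0 ->
  exists a b, [/\ (a != 0) || (b != 0), polar0 c a b = 0 & polar1 c a b = 0].
Proof.
case: c => -[c0 c1] c2; rewrite /qdisc /polar0 /polar1 /= => d0.
have [c1z|c1n] := eqVneq c1 0; last first.
  exists (- c1), (2%:R * c0); split; first by rewrite oppr_eq0 c1n.
    by ring.
  by rewrite -[RHS]oppr0 -d0; ring.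
have [c0z|c0n] := eqVneq c0 0.
  by exists 1, 0; split; rewrite ?oner_eq0 // c1z ?c0z; ring.
exists (- c1), (2%:R * c0); split; first by rewrite mulf_neq0 ?nz ?orbT.
  by ring.
by rewrite -[RHS]oppr0 -d0; ring.
Qed.

(** The vector (- polar1, polar0) is orthogonal to (a, b), and the form takes the value - z^2
    [qdisc c] on it. *)
Lemma conic_normal_form (c : k * k * k) a b z Y0 Y1 : z ^+ 2 = qform c a b ->
  qform c (Y0 * a - Y1 * polar1 c a b) (Y0 * b + Y1 * polar0 c a b) =
  z ^+ 2 * (Y0 ^+ 2 - qdisc c * Y1 ^+ 2).
Proof. by move->; rewrite /qform /polar0 /polar1 /qdisc; ring. Qed.

(** If z = 0, then (a, b) is an isotropic vector of a nondegenerate form, which therefore represents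
    1. *)
Lemma conic_point_neq0 (c : k * k * k) : qdisc c != 0 -> has_point (qform c) ->
  exists a b z, z != 0 /\ z ^+ 2 = qform c a b.
Proof.
move=> dn0 [a [b [z [abn0 zE]]]].
have [z0|zn0] := eqVneq z 0; last by exists a, b, z.
have q0 : qform c a b = 0 by rewrite -zE z0 expr0n.
have [e0 [e1 pn0]] : exists e0 e1, polar0 c a b * e0 + polar1 c a b * e1 != 0.
  have [p0|p0] := eqVneq (polar0 c a b) 0; last by exists 1, 0; rewrite mulr1 mulr0 addr0.
  have [p1|p1] := eqVneq (polar1 c a b) 0; last by exists 0, 1; rewrite mulr1 mulr0 add0r.
  have ha : qdisc c * a = 0.
    transitivity (c.1.2 * polar1 c a b - 2%:R * c.2 * polar0 c a b).
      by rewrite /qdisc /polar0 /polar1; ring.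
    by rewrite p0 p1 !mulr0 subr0.
  have hb : qdisc c * b = 0.
    transitivity (c.1.2 * polar0 c a b - 2%:R * c.1.1 * polar1 c a b).
      by rewrite /qdisc /polar0 /polar1; ring.
    by rewrite p0 p1 !mulr0 subr0.
  move/eqP: ha; move/eqP: hb; rewrite !mulf_eq0 (negPf dn0) /= => /eqP b0 /eqP a0.
  by rewrite a0 b0 eqxx in abn0.
set p := polar0 c a b * e0 + polar1 c a b * e1 in pn0.
(* Along t (a, b) + (e0, e1) the form is affine in t with slope [p]; this t gives the value 1. *)
pose t := (1 - qform c e0 e1) / p.
exists (t * a + e0), (t * b + e1), 1; split; first exact: oner_neq0.
transitivity (t ^+ 2 * qform c a b + t * p + qform c e0 e1).
  by rewrite q0 mulr0 add0r /t divfK // subrK expr1n.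
by rewrite /p /qform /polar0 /polar1; ring.
Qed.
End Conic.

(** The leading coefficient is singled out because it is the value at the point t = oo of the
    line. *)
Lemma quartic_line (R : comPzRingType) (c : nat -> R) (u0 u1 w0 w1 : R) :
  exists e : nat -> R, e 4%N = quartic c u0 u1 /\
    forall t, quartic c (t * u0 + w0) (t * u1 + w1) = quartic e t 1.
Proof.
exists (nth 0 [::
  c 0%N * w1 ^+ 4 + c 1%N * w0 * w1 ^+ 3 + c 2%N * w0 ^+ 2 * w1 ^+ 2 + c 3%N * w0 ^+ 3 * w1
    + c 4%N * w0 ^+ 4;
  4%:R * c 0%N * u1 * w1 ^+ 3 + 3%:R * c 1%N * w0 * u1 * w1 ^+ 2 + c 1%N * u0 * w1 ^+ 3
    + 2%:R * c 2%N * w0 ^+ 2 * u1 * w1 + 2%:R * c 2%N * u0 * w0 * w1 ^+ 2 + c 3%N * w0 ^+ 3 * u1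
    + 3%:R * c 3%N * u0 * w0 ^+ 2 * w1 + 4%:R * c 4%N * u0 * w0 ^+ 3;
  6%:R * c 0%N * u1 ^+ 2 * w1 ^+ 2 + 3%:R * c 1%N * w0 * u1 ^+ 2 * w1
    + 3%:R * c 1%N * u0 * u1 * w1 ^+ 2 + c 2%N * w0 ^+ 2 * u1 ^+ 2
    + 4%:R * c 2%N * u0 * w0 * u1 * w1 + c 2%N * u0 ^+ 2 * w1 ^+ 2
    + 3%:R * c 3%N * u0 * w0 ^+ 2 * u1 + 3%:R * c 3%N * u0 ^+ 2 * w0 * w1
    + 6%:R * c 4%N * u0 ^+ 2 * w0 ^+ 2;
  4%:R * c 0%N * u1 ^+ 3 * w1 + c 1%N * w0 * u1 ^+ 3 + 3%:R * c 1%N * u0 * u1 ^+ 2 * w1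
    + 2%:R * c 2%N * u0 * w0 * u1 ^+ 2 + 2%:R * c 2%N * u0 ^+ 2 * u1 * w1
    + 3%:R * c 3%N * u0 ^+ 2 * w0 * u1 + c 3%N * u0 ^+ 3 * w1 + 4%:R * c 4%N * u0 ^+ 3 * w0;
  quartic c u0 u1]); split=> // t.
rewrite /quartic /=; ring.
Qed.

(** * Infinitely many fibres with a k-point *)

Section Fibres.
Variables (k : fieldType) (s : conic_coeffs k).
Hypothesis char0 : [pchar k] =i pred0.
Hypothesis cb : conic_bundle_220 s.
Hypothesis smooth : smooth_total_space s.
Let nz n : n.+1%:R != 0 :> k := pchar0_natr_neq0 char0 n.

(** A kernel vector of a degenerate form would give, with z = 0, a singular point of the fibre. The
    point [v] cannot have y0 = y1 = 0, since s22 != 0. *)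
Lemma smooth_fiber_point v :
  rational_point s v -> smooth_fiber s (fun i => v (ix i)) ->
  let c := disc_form s idfun (fun i => v (ix i)) in qdisc c != 0 /\ has_point (qform c).
Proof.
set x := fun i => v (ix i); move=> [[xn0 yn0] v0] sm c.
have s22n := s22_neq0 cb.
have {v0} v0 : eval_at idfun (cox_tuple x (v (iy y0)) (v (iy y1)) (v (iy y2))) (conic_eq s) = 0.
  by rewrite -v0; apply: meval_eq => i; rewrite -cox_tuple_eta.
have vE := (on_conicP idfun char0 s22n _ _ _ _).1 v0.
split; last first.
  exists (v (iy y0)), (v (iy y1)), (zform s idfun x (v (iy y0)) (v (iy y1)) (v (iy y2))); split=>
    //.
  apply: contraT; rewrite negb_or !negbK => /andP[/eqP a0 /eqP b0].
  move: vE; rewrite a0 b0 (_ : qform _ _ _ = 0); last by rewrite /qform; ring.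
  rewrite /zform !mulr0 !add0r => /eqP.
  rewrite expf_eq0 /= !mulf_eq0 (negPf (nz 1)) (negPf s22n) /= => /eqP c0.
  by have [j] := yn0; have [->|[->|->]] := ord3P j; rewrite ?a0 ?b0 ?c0 eqxx.
apply/eqP => d0.
have [a [b [abn0 P0 P1]]] := degenerate_kernel char0 d0.
have fn0 : - (4%:R * s22 s) != 0 by rewrite oppr_eq0 mulf_neq0 ?nz.
have [e z0] := zform_surj idfun char0 s22n x a b 0.
have q0 : qform c a b = 0.
  have /eqP := qform_polar c a b.
  by rewrite P0 P1 !mul0r addr0 mulf_eq0 (negPf (nz 1)) => /eqP.
have [E0 E1 E2] := conic_dy_eq0 z0.
have cancel_fn0 r : 0 = - (4%:R * s22 s) * r -> r = 0.
  by move/esym/eqP; rewrite mulf_eq0 (negPf fn0) => /eqP.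
have pv : point_on s idfun (cox_tuple x a b e).
  split; last by apply/(on_conicP idfun char0 s22n); rewrite z0 expr0n q0.
  split; first by have [i xi] := xn0; exists i; rewrite cox_tuple_x.
  by case/orP: abn0 => h; [exists y0 | exists y1]; rewrite cox_tuple_y.
have [|j] := sm _ _ _ pv; first by move=> i; rewrite cox_tuple_x.
case/negP; apply/eqP.
have [->|[->|->]] := ord3P j.
- by apply: cancel_fn0; rewrite -E0 P0.
- by apply: cancel_fn0; rewrite -E1 P1.
- by rewrite E2 z0.
Qed.

Definition line (R : nzRingType) (u w : 'I_2 -> R) (t : R) (i : 'I_2) := t * u i + w i.

Lemma line_neq0 (R : fieldType) (u w : 'I_2 -> R) t :
  u ord0 * w ord_max - u ord_max * w ord0 != 0 -> exists i, line u w t i != 0.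
Proof.
move=> uw; apply: NNPP => nex.
have l0 i : line u w t i = 0.
  by apply/eqP; apply: contra_notT nex => h; exists i.
case/eqP: uw; transitivity (u ord0 * line u w t ord_max - u ord_max * line u w t ord0).
  by rewrite /line; ring.
by rewrite !l0 !mulr0 subrr.
Qed.

Lemma infinite_good_fibres (u w : 'I_2 -> k) :
  u ord0 * w ord_max - u ord_max * w ord0 != 0 ->
  qdisc (disc_form s idfun u) != 0 -> has_point (qform (disc_form s idfun u)) ->
  infinite (fun t => has_point (qform (disc_form s idfun (line u w t)))).
Proof.
move=> uw dn0 /(conic_point_neq0 dn0)[a [b [z [zn0 zE]]]].
have [hA hB hC] := disc_homog cb.
have [cA EA] := quarticP hA; have [cB EB] := quarticP hB; have [cC EC] := quarticP hC.
have evq (L : fieldType) (iota : {rmorphism k -> L}) x : disc_form s iota x =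
   (quartic (fun i => iota (cA i)) (x ord0) (x ord_max),
    quartic (fun i => iota (cB i)) (x ord0) (x ord_max),
    quartic (fun i => iota (cC i)) (x ord0) (x ord_max)).
  by rewrite /disc_form EA EB EC !ev_quartic.
have [eA [eA4 lA]] := quartic_line cA (u ord0) (u ord_max) (w ord0) (w ord_max).
have [eB [eB4 lB]] := quartic_line cB (u ord0) (u ord_max) (w ord0) (w ord_max).
have [eC [eC4 lC]] := quartic_line cC (u ord0) (u ord_max) (w ord0) (w ord_max).
set q := disc_form s idfun u in dn0 zE *.
have qE : q = (eA 4%N, eB 4%N, eC 4%N) by rewrite /q evq eA4 eB4 eC4.
pose P0 := polar0 q a b; pose P1 := polar1 q a b.
(* The coefficient form of t^i in the orthogonal basis (a, b), (- P1, P0), divided by z^2; the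
   leading form becomes Y0^2 - d Y1^2. *)
pose tr i : k * k * k := (qform (eA i, eB i, eC i) a b / z ^+ 2,
  (- polar0 (eA i, eB i, eC i) a b * P1 + polar1 (eA i, eB i, eC i) a b * P0) / z ^+ 2,
  qform (eA i, eB i, eC i) (- P1) P0 / z ^+ 2).
pose d := qdisc q.
have lineE t : disc_form s idfun (line u w t) = (quartic eA t 1, quartic eB t 1, quartic eC t 1).
  by rewrite evq /line /= lA lB lC.
have fE t Y0 Y1 : qform (disc_form s idfun (line u w t)) (Y0 * a - Y1 * P1) (Y0 * b + Y1 * P0) =
    z ^+ 2 * fibre d (tr 3%N) (tr 2%N) (tr 1%N) (tr 0%N) t Y0 Y1.
  rewrite lineE /fibre /tr.
  have -> : qform (quartic eA t 1, quartic eB t 1, quartic eC t 1) (Y0 * a - Y1 * P1)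
    (Y0 * b + Y1 * P0) =
     qform q (Y0 * a - Y1 * P1) (Y0 * b + Y1 * P0) * t ^+ 4 +
     qform (eA 3%N, eB 3%N, eC 3%N) (Y0 * a - Y1 * P1) (Y0 * b + Y1 * P0) * t ^+ 3 +
     qform (eA 2%N, eB 2%N, eC 2%N) (Y0 * a - Y1 * P1) (Y0 * b + Y1 * P0) * t ^+ 2 +
     qform (eA 1%N, eB 1%N, eC 1%N) (Y0 * a - Y1 * P1) (Y0 * b + Y1 * P0) * t +
     qform (eA 0%N, eB 0%N, eC 0%N) (Y0 * a - Y1 * P1) (Y0 * b + Y1 * P0).
    by rewrite qE /quartic /qform /=; ring.
  rewrite (conic_normal_form _ _ zE) -/d.
  by rewrite /qform /polar0 /polar1 /=; field.
have detE : P0 * a + P1 * b = 2%:R * z ^+ 2 by rewrite zE qform_polar.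
have det0 : 2%:R * z ^+ 2 != 0 by rewrite mulf_neq0 ?expf_neq0.
have basis r0 r1 : exists Y0 Y1, r0 = Y0 * a - Y1 * P1 /\ r1 = Y0 * b + Y1 * P0.
  exists ((r0 * P0 + r1 * P1) / (2%:R * z ^+ 2)), ((a * r1 - b * r0) / (2%:R * z ^+ 2)).
  by split; [transitivity (r0 * (P0 * a + P1 * b) / (2%:R * z ^+ 2)) |
    transitivity (r1 * (P0 * a + P1 * b) / (2%:R * z ^+ 2))];
    rewrite ?detE ?mulfK // -?detE; field; rewrite detE.
have qform_inj (c c' : k * k * k) : (forall r0 r1, qform c r0 r1 = qform c' r0 r1) -> c = c'.
  case: c c' => -[c0 c1] c2 [[c0' c1'] c2'] h.
  have h0 : c0 = c0' by have := h 1 0; rewrite /qform /= !(mulr0, mulr1, expr0n, expr1n, addr0).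
  have h2 : c2 = c2' by have := h 0 1;
    rewrite /qform /= !(mulr0, mulr1, mul0r, expr0n, expr1n, addr0, add0r).
  by have := h 1 1; rewrite /qform /= h0 h2 !(mulr1, expr1n) => /addIr /addrI ->.
have N2 t : exists Y0 Y1, fibre d (tr 3%N) (tr 2%N) (tr 1%N) (tr 0%N) t Y0 Y1 != 0.
  apply: NNPP => nex.
  have f0 Y0 Y1 : fibre d (tr 3%N) (tr 2%N) (tr 1%N) (tr 0%N) t Y0 Y1 = 0.
    by apply/eqP; apply: contra_notT nex => fn; exists Y0, Y1.
  have /negP[] := disc_form_neq0 char0 cb smooth idfun (line_neq0 t uw).
  apply/eqP; apply: qform_inj => r0 r1; have [Y0 [Y1 [-> ->]]] := basis r0 r1.
  by rewrite fE f0 mulr0 /qform /=; ring.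
(* Otherwise F = g(t) q with g given by the monic quartic [G], and at a root of [G] in an extension
   the discriminant form would vanish, against smoothness. *)
have N1 : neg_norm_multiple d (fibre d (tr 3%N) (tr 2%N) (tr 1%N) (tr 0%N)).
  case=> g gE.
  pose G : {poly k} := 'X^4 + ((tr 3%N).1.1)%:P * 'X^3 + ((tr 2%N).1.1)%:P * 'X^2
    + ((tr 1%N).1.1)%:P * 'X + ((tr 0%N).1.1)%:P.
  have GE t : G.[t] = g t.
    have := gE t 1 0; rewrite expr1n expr0n /= mulr0 subr0 mul1r => <-.
    rewrite /G /fibre !(hornerD, hornerM, hornerC, hornerXn, hornerX).
    rewrite /qform; move: (tr _) (tr _) (tr _) (tr _) => *; ring.
  have dE t : disc_form s idfun (line u w t) = (g t * q.1.1, g t * q.1.2, g t * q.2).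
    apply: qform_inj => r0 r1; have [Y0 [Y1 [-> ->]]] := basis r0 r1.
    rewrite fE gE; transitivity (g t * qform q (Y0 * a - Y1 * P1) (Y0 * b + Y1 * P0)).
      by rewrite (conic_normal_form _ _ zE) -/d; ring.
    by rewrite qform_scale.
  have szG : (1 < size G)%N.
    have -> : G = Poly [:: (tr 0%N).1.1; (tr 1%N).1.1; (tr 2%N).1.1; (tr 3%N).1.1; 1].
      by rewrite /G /= !cons_poly_def; ring.
    by rewrite (PolyK (c := 0)) //= oner_eq0.
  have [L [iota [r rG]]] := root_in_extension szG.
  have r0 (c e : nat -> k) (qc : k) :
      (forall t, quartic c (t * u ord0 + w ord0) (t * u ord_max + w ord_max) = quartic e t 1) ->
      (forall t, quartic e t 1 = g t * qc) ->
      quartic (fun i => iota (c i)) (r * iota (u ord0) + iota (w ord0))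
        (r * iota (u ord_max) + iota (w ord_max)) = 0.
    move=> lc eg.
    pose pc : {poly k} := quartic (fun i => (c i)%:P) ('X * (u ord0)%:P + (w ord0)%:P)
      ('X * (u ord_max)%:P + (w ord_max)%:P).
    (* The identity holds at every scalar of an infinite field, hence between polynomials, and can
       then be evaluated at [r]. *)
    have pcE : pc - G * qc%:P = 0.
      apply: (infinite_poly0 (infinite_pchar0 char0)) => t _.
      rewrite hornerD hornerN hornerM hornerC GE -eg -lc.
      rewrite -[pc.[t]]/(horner_eval t pc) /pc quartic_morph /= !horner_evalE.
      rewrite !(hornerD, hornerM, hornerX, hornerC) /quartic !horner_evalE !hornerC; ring.
    have := congr1 (fun p => (map_poly iota p).[r]) pcE.
    rewrite rmorphB rmorphM /= hornerD hornerN hornerM (eqP rG) mul0r subr0 rmorph0 horner0 => <-.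
    rewrite -[RHS]/(horner_eval r (map_poly iota pc)) /pc !quartic_morph /= !horner_evalE.
    rewrite !(rmorphD, rmorphM) /= !map_polyX !map_polyC /=.
    rewrite !(hornerD, hornerM, hornerX, hornerC) /quartic !horner_evalE !map_polyC !hornerC //.
  have uwL : iota (u ord0) * iota (w ord_max) - iota (u ord_max) * iota (w ord0) != 0.
    by rewrite -!rmorphM -rmorphB fmorph_eq0.
  have /negP[] := disc_form_neq0 char0 cb smooth iota
    (line_neq0 (u := iota \o u) (w := iota \o w) r uwL).
  have dE' t := etrans (esym (lineE t)) (dE t).
  rewrite evq /line /=.
  by rewrite (r0 cA eA q.1.1) ?(r0 cB eB q.1.2) ?(r0 cC eC q.2) // => t; case: (dE' t).
apply: infinite_sub (infinite_fibre char0 dn0 N1 N2) => t [Y0 [Y1 [Z [Yn0 ZE]]]].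
exists (Y0 * a - Y1 * P1), (Y0 * b + Y1 * P0), (z * Z); split; last first.
  by rewrite fE exprMn ZE.
apply: contraT; rewrite negb_or !negbK => /andP[/eqP h0 /eqP h1].
have : 2%:R * z ^+ 2 * Y0 = 0.
  by transitivity (P0 * (Y0 * a - Y1 * P1) + P1 * (Y0 * b + Y1 * P0));
    [rewrite -detE; ring | rewrite h0 h1; ring].
have : 2%:R * z ^+ 2 * Y1 = 0.
  by transitivity (a * (Y0 * b + Y1 * P0) - b * (Y0 * a - Y1 * P1));
    [rewrite -detE; ring | rewrite h0 h1; ring].
move=> /eqP; rewrite mulf_eq0 (negPf det0) /= => /eqP Y10 /eqP.
by rewrite mulf_eq0 (negPf det0) /= => /eqP Y00; rewrite Y00 Y10 eqxx in Yn0.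
Qed.
End Fibres.

(** * From infinitely many fibres to Zariski density *)

Section Vanish.
Variables (k L : fieldType) (iota : {rmorphism k -> L}).

Lemma infinite_fmorph (P : k -> Prop) : infinite P ->
  infinite (fun X : L => exists2 r, P r & iota r = X).
Proof.
move=> iP; apply: infinite_image => // y.
have [[r0 r0E]|nex] := classic (exists r, iota r = y); last first.
  by exists [::] => r _ rE; case: nex; exists r.
by exists [:: r0] => r _ rE; rewrite inE -(inj_eq (fmorph_inj iota)) rE r0E.
Qed.

Lemma eval_at_ext v v' F : v =1 v' -> eval_at iota v F = eval_at iota v' F.
Proof. exact: meval_eq. Qed.

(** Restricted to a line, [F] is a polynomial in the parameter with infinitely many zeros. *)
Lemma line_vanish F (v w : 'I_(2 + 3) -> L) (P : k -> Prop) : infinite P ->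
  (forall r, P r -> eval_at iota (fun i => v i + iota r * w i) F = 0) ->
  forall X, eval_at iota (fun i => v i + X * w i) F = 0.
Proof.
move=> iP F0 X.
have [p pE] : exists p : {poly L}, forall X, p.[X] = eval_at iota (fun i => v i + X * w i) F.
  elim/mpoly_ring_ind: F {F0} => [c|i|q r [p pE] [p' pE']|q r [p pE] [p' pE']].
  - by exists (iota c)%:P => Y; rewrite hornerC eval_atC.
  - exists ((v i)%:P + 'X * (w i)%:P) => Y.
    by rewrite eval_atX hornerD hornerM !hornerC hornerX.
  - by exists (p + p') => Y; rewrite hornerD pE pE' -eval_atD.
  - by exists (p * p') => Y; rewrite hornerM pE pE' -eval_atM.
rewrite -pE (_ : p = 0) ?horner0 //.
by apply: (infinite_poly0 (infinite_fmorph iP)) => _ [r Pr <-]; rewrite pE F0.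
Qed.

Hypothesis char0 : [pchar k] =i pred0.

(** For fixed t the given points lie on a line of direction [e0], so [F] vanishes on that line; then
    t varies. *)
Lemma plane_vanish F (v e0 e1 : 'I_(2 + 3) -> L) (P : k -> Prop) : infinite P ->
  (forall r t, P r -> t != 0 ->
     eval_at iota (fun i => v i + iota t * (iota r * e0 i + e1 i)) F = 0) ->
  forall X Y, eval_at iota (fun i => v i + X * e0 i + Y * e1 i) F = 0.
Proof.
move=> iP F0 X Y; apply: (line_vanish (v := fun i => v i + X * e0 i)
  (infinite_avoid [:: 0] (infinite_pchar0 char0))) => t [_]; rewrite inE => tn0.
have tL : iota t != 0 by rewrite fmorph_eq0.
have H := @line_vanish F (fun i => v i + iota t * e1 i) (fun i =>
  iota t * e0 i) P iP _ (X / iota t).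
rewrite -{}H => [|r Pr].
  by apply: eval_at_ext => i; field.
by rewrite -[RHS](F0 r t) //; apply: eval_at_ext => i; ring.
Qed.
End Vanish.

Section NormalForm.
Variables (k : fieldType) (s : conic_coeffs k).
Hypothesis char0 : [pchar k] =i pred0.
Hypothesis s22n0 : s22 s != 0.

Definition has_normal_form F := exists R0 R1 : cox_ring k,
  forall (L : fieldType) (iota : {rmorphism k -> L}) x a b c,
  eval_at iota (cox_tuple x a b c) (conic_eq s) = 0 ->
  eval_at iota (cox_tuple x a b c) F = eval_at iota (cox_tuple x a b 0) R0
    + eval_at iota (cox_tuple x a b 0) R1 * zform s iota x a b c.

Lemma normal_form F : has_normal_form F.
Proof.
pose X0 : cox_ring k := 'X_(iy y0); pose X1 : cox_ring k := 'X_(iy y1).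
have two : 2%:R != 0 :> k := pchar0_natr_neq0 char0 1.
elim/mpoly_ring_ind: F => [c|i|p q [P0 [P1 IHp]] [Q0 [Q1 IHq]]|p q [P0 [P1 IHp]] [Q0 [Q1 IHq]]].
- by exists c%:MP, 0%:MP => *; rewrite !eval_atC rmorph0 mul0r addr0.
- have keep : (forall (L : fieldType) (iota : {rmorphism k -> L}) (x : 'I_2 -> L) a b c,
      cox_tuple x a b c i = cox_tuple x a b 0 i) -> has_normal_form 'X_i.
    by move=> h; exists 'X_i, 0%:MP => *; rewrite !eval_atX eval_atC rmorph0 mul0r addr0 h.
  rewrite -[i]splitK in keep *; case: (split i) keep => j /= keep.
    by apply: keep => *; rewrite !cox_tuple_x.
  have [jE|[jE|jE]] := ord3P j; rewrite jE in keep *.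
  + by apply: keep => *; rewrite !cox_tuple_y.
  + by apply: keep => *; rewrite !cox_tuple_y.
  (* This is y2 = (z - s02 y0 - s12 y1) / (2 s22). *)
  exists ((- (2%:R * s22 s)^-1)%:MP * (to_cox (s02 s) * X0 + to_cox (s12 s) * X1)),
    ((2%:R * s22 s)^-1)%:MP.
  move=> L iota x a b c _.
  rewrite !(eval_atM, eval_atD) !eval_to_cox !eval_atC !eval_atX !cox_tuple_y /=.
  rewrite !(ev_ext _ _ (cox_tuple_x x a b 0)) rmorphN fmorphV rmorphM rmorph_nat /zform.
  have t2 : 2%:R != 0 :> L by rewrite -(rmorph_nat iota) fmorph_eq0.
  have st : iota (s22 s) != 0 by rewrite fmorph_eq0.
  by gen_ev; field; rewrite st t2.
- exists (P0 + Q0), (P1 + Q1) => L iota x a b c h.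
  rewrite !eval_atD IHp // IHq //; move: (zform _ _ _ _ _ _) => Z.
  move: (eval_at _ _ P0) (eval_at _ _ P1) (eval_at _ _ Q0) (eval_at _ _ Q1) => *; ring.
(* F as an element of the Cox ring, which replaces z^2 in a product. *)
pose D := to_cox (disc00 s) * (X0 * X0) + to_cox (disc01 s) * (X0 * X1)
  + to_cox (disc11 s) * (X1 * X1).
exists (P0 * Q0 + P1 * Q1 * D), (P0 * Q1 + P1 * Q0) => L iota x a b c h.
have Dv : eval_at iota (cox_tuple x a b 0) D = zform s iota x a b c ^+ 2.
  rewrite ((on_conicP iota char0 s22n0 _ _ _ _).1 h) /D.
  rewrite !(eval_atM, eval_atD) !eval_to_cox !eval_atX !cox_tuple_y /=.
  by rewrite !(ev_ext _ _ (cox_tuple_x x a b 0)) /disc_form /qform /=; gen_ev; ring.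
rewrite eval_atM IHp // IHq //.
rewrite (eval_atD _ _ (P0 * Q0)) (eval_atD _ _ (P0 * Q1)) (eval_atM _ _ (P1 * Q1)) !eval_atM Dv.
move: (eval_at iota _ P0) (eval_at iota _ P1) (eval_at iota _ Q0) (eval_at iota _ Q1) => *; ring.
Qed.
End NormalForm.

Lemma cox_tuple_lin (R : nzRingType) (x x' : 'I_2 -> R) a b c t a' b' c' i :
  cox_tuple x a b c i + t * cox_tuple x' a' b' c' i =
  cox_tuple (fun j => x j + t * x' j) (a + t * a') (b + t * b') (c + t * c') i.
Proof.
rewrite -[i]splitK; case: (split i) => j /=; first by rewrite !cox_tuple_x.
by rewrite !cox_tuple_y; have [->|[->|->]] := ord3P j.
Qed.

Lemma cox_tuple_ext (R : nzRingType) (x x' : 'I_2 -> R) a b c i :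
  x =1 x' -> cox_tuple x a b c i = cox_tuple x' a b c i.
Proof.
move=> xx'; rewrite -[i]splitK; case: (split i) => j /=; first by rewrite !cox_tuple_x.
by rewrite !cox_tuple_y.
Qed.

Lemma eval_at_fmorph (k L : fieldType) (iota : {rmorphism k -> L}) (v : 'I_(2 + 3) -> k) F :
  eval_at iota (fun i => iota (v i)) F = iota (eval_at idfun v F).
Proof.
elim/mpoly_ring_ind: F => [c|i|p q IHp IHq|p q IHp IHq].
- by rewrite !eval_atC.
- by rewrite !eval_atX.
- by rewrite !eval_atD IHp IHq rmorphD.
- by rewrite !eval_atM IHp IHq rmorphM.
Qed.

Section Density.
Variables (k : fieldType) (s : conic_coeffs k).
Hypothesis char0 : [pchar k] =i pred0.
Hypothesis cb : conic_bundle_220 s.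
Let nz n : n.+1%:R != 0 :> k := pchar0_natr_neq0 char0 n.
Let s22n := s22_neq0 cb.

Lemma disc_form_scale (x : 'I_2 -> k) l : disc_form s idfun (fun i => l * x i) =
  (l ^+ 4 * (disc_form s idfun x).1.1, l ^+ 4 * (disc_form s idfun x).1.2,
    l ^+ 4 * (disc_form s idfun x).2).
Proof.
have [/quarticP[cA EA] /quarticP[cB EB] /quarticP[cC EC]] := disc_homog cb.
by rewrite /disc_form EA EB EC !ev_quartic !quartic_scale.
Qed.

(** In the coordinate 1/t the discriminant is a polynomial whose value at 0 is the nonzero
    discriminant at [u]; t = 0 is listed separately. *)
Lemma degenerate_fibres_finite (u w : 'I_2 -> k) : qdisc (disc_form s idfun u) != 0 ->
  exists bad : seq k, forall t, qdisc (disc_form s idfun (line u w t)) = 0 -> t \in bad.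
Proof.
move=> dn0.
have [/quarticP[cA EA] /quarticP[cB EB] /quarticP[cC EC]] := disc_homog cb.
have evq x : disc_form s idfun x =
   (quartic cA (x ord0) (x ord_max), quartic cB (x ord0) (x ord_max),
     quartic cC (x ord0) (x ord_max)).
  by rewrite /disc_form EA EB EC !ev_quartic.
have [eA [_ lA]] := quartic_line cA (w ord0) (w ord_max) (u ord0) (u ord_max).
have [eB [_ lB]] := quartic_line cB (w ord0) (w ord_max) (u ord0) (u ord_max).
have [eC [_ lC]] := quartic_line cC (w ord0) (w ord_max) (u ord0) (u ord_max).
pose P e : {poly k} := quartic (fun i => (e i)%:P) 'X 1.
have PE (e : nat -> k) t : (P e).[t] = quartic e t 1.
  rewrite -[LHS]/(horner_eval t _) /P quartic_morph /= !horner_evalE hornerX hornerC.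
  by rewrite /quartic !horner_evalE !hornerC.
pose p := qdisc (P eA, P eB, P eC).
have pE t : p.[t] = qdisc (disc_form s idfun (line w u t)).
  rewrite evq /line lA lB lC -!PE /p /qdisc /= -polyC_natr.
  by rewrite !(hornerD, hornerN, hornerM, horner_exp, hornerC).
have p0 : p != 0.
  apply: contraNneq dn0 => p0; rewrite -(horner0 0) -p0 pE; apply/eqP.
  rewrite /disc_form; congr (qdisc (_, _, _)); apply: ev_ext => i; by rewrite /line mul0r add0r.
have [r rP] := poly_roots_finite p0.
exists (0 :: [seq t^-1 | t <- r]) => t.
have [->|tn0] := eqVneq t 0; first by rewrite inE eqxx.
have -> : disc_form s idfun (line u w t) = disc_form s idfun (fun i => t * line w u t^-1 i).
  rewrite /disc_form; congr (_, _, _); apply: ev_ext => i;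
    rewrite /line mulrDr mulrA divff // mul1r addrC //.
rewrite disc_form_scale qdisc_scale => /eqP.
rewrite mulf_eq0 !expf_eq0 /= (negPf tn0) /= => /eqP d0.
rewrite inE; apply/orP; right; rewrite -[t]invrK; apply: map_f; apply: rP.
by rewrite rootE pE d0.
Qed.

(** These are ratios Y0 / Y1 for which Y0^2 - d Y1^2 is a nonzero square, taken from the
    parametrization (s^2 + d : 2 s). *)
Lemma infinite_param_slopes (d : k) : d != 0 ->
  infinite (fun r => exists s0, [/\ s0 != 0, s0 ^+ 2 - d != 0 & r = (s0 ^+ 2 + d) / (2%:R * s0)]).
Proof.
move=> dn0.
have q0 : 'X * ('X^2 - d%:P) != 0 by rewrite mulf_neq0 ?polyX_eq0 // -size_poly_gt0 size_XnsubC.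
have iP := infinite_nonroot (infinite_pchar0 char0) q0.
have H : infinite (fun r => exists2 s0, True /\ ('X * ('X^2 - d%:P)).[s0] != 0 &
  (s0 ^+ 2 + d) / (2%:R * s0) = r).
  apply: (infinite_rational_image (N := 'X^2 + d%:P) (D := 'X *+ 2) iP) => [s0 [_]|y].
    rewrite hornerM hornerX mulf_eq0 negb_or => /andP[s0n _].
    rewrite [RHS](_ : _ = s0 ^+ 2 + d); last by rewrite !hornerE.
    by rewrite hornerMn hornerX -[s0 *+ 2]mulr_natl divfK // mulf_neq0 ?nz.
  apply: contraNneq dn0 => h; have := congr1 (fun p => p.[0]) h.
  rewrite hornerD hornerN hornerZ hornerMn hornerX mul0rn mulr0 subr0 horner0.
  by rewrite !hornerE /= => /eqP; rewrite expr0n add0r.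
apply: infinite_sub H => _ [s0 [_ s0P] <-]; exists s0; move: s0P.
by rewrite !hornerE mulf_eq0 negb_or => /andP[s0n s0d].
Qed.

Lemma dense_of_infinite_good_fibres (u w : 'I_2 -> k) :
  u ord0 * w ord_max - u ord_max * w ord0 != 0 ->
  qdisc (disc_form s idfun u) != 0 ->
  infinite (fun t => has_point (qform (disc_form s idfun (line u w t)))) ->
  rational_points_dense s.
Proof.
move=> uw dn0 iT S _ Srat L iota v [_ von] F SF.
have [bad badP] := degenerate_fibres_finite w dn0.
have {}iT := infinite_avoid bad iT.
have [R0 [R1 NF]] := normal_form char0 s22n F.
(* On a good fibre both signs of z are rational over infinitely many (y0 : y1), so [R0] and [R1]
   vanish there separately, for every rescaling [l] of x and [m] of (y0, y1). *)
have onfib t : (has_point (qform (disc_form s idfun (line u w t))) /\ t \notin bad) ->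
    exists a b a' b' (P : k -> Prop), [/\ a * b' - b * a' != 0, infinite P &
      forall l r m, l != 0 -> P r -> m != 0 ->
        let x i := l * line u w t i in
        let y := (m * (r * a + a'), m * (r * b + b')) in
        eval_at idfun (cox_tuple x y.1 y.2 0) R0 = 0 /\ eval_at idfun (cox_tuple x y.1 y.2 0) R1 =
          0].
  move=> [pt tbad]; pose c := disc_form s idfun (line u w t).
  have dt : qdisc c != 0 by apply: contra tbad => /eqP /badP.
  have [a [b [z [zn0 zE]]]] := conic_point_neq0 dt pt.
  exists a, b, (- polar1 c a b), (polar0 c a b).
  exists (fun r => exists s0, [/\ s0 != 0, s0 ^+ 2 - qdisc c != 0 & r =
    (s0 ^+ 2 + qdisc c) / (2%:R * s0)]).
  split; last 1 first.
  - move=> l r m ln0 [s0 [s0n s0d rE]] mn0 x y.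
    pose z' := l ^+ 2 * (m / (2%:R * s0)) * z * (s0 ^+ 2 - qdisc c).
    have s2n : 2%:R * s0 != 0 by rewrite mulf_neq0 ?nz.
    have z'n0 : z' != 0 by rewrite /z' ?(mulf_neq0, expf_neq0, invr_neq0).
    have qE : qform (disc_form s idfun x) y.1 y.2 = z' ^+ 2.
      have NFm := conic_normal_form (s0 ^+ 2 + qdisc c) (2%:R * s0) zE.
      rewrite disc_form_scale -/c.
      transitivity (l ^+ 4 * (m / (2%:R * s0)) ^+ 2 * qform c
        ((s0 ^+ 2 + qdisc c) * a - 2%:R * s0 * polar1 c a b)
        ((s0 ^+ 2 + qdisc c) * b + 2%:R * s0 * polar0 c a b)).
        rewrite qform_scale /y rE; move: (polar0 _ _ _) (polar1 _ _ _) (qdisc c) => p0 p1 D.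
        by rewrite /qform /=; field; rewrite s0n nz.
      by rewrite NFm /z'; ring.
    have rat e : e ^+ 2 = 1 -> eval_at idfun (cox_tuple x y.1 y.2 0) R0
        + eval_at idfun (cox_tuple x y.1 y.2 0) R1 * (e * z') = 0.
      move=> e1; have [g gE] := zform_surj idfun char0 s22n x y.1 y.2 (e * z').
      have con : eval_at idfun (cox_tuple x y.1 y.2 g) (conic_eq s) = 0.
        by apply/(on_conicP idfun char0 s22n); rewrite gE qE exprMn e1 mul1r.
      rewrite -gE -NF //; apply: Srat SF; split=> //; split.
        have [i li] := line_neq0 t uw; exists i; rewrite cox_tuple_x /x mulf_neq0 //.
      apply: NNPP => nex.
      have y00 : y.1 = 0.
        apply/eqP; apply: contra_notT nex => h; exists y0; by rewrite cox_tuple_y.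
      have y10 : y.2 = 0.
        apply/eqP; apply: contra_notT nex => h; exists y1; by rewrite cox_tuple_y.
      case/negP: (expf_neq0 2 z'n0); rewrite -qE y00 y10 /qform; apply/eqP; ring.
    have h1 := rat 1 (expr1n _ _); have h2 := rat (-1) (etrans (sqrrN _) (expr1n _ _)).
    move: h1 h2; move: (eval_at _ _ R0) (eval_at _ _ R1) => r0 r1 h1 h2.
    have r1z : r1 = 0.
      have /eqP : 2%:R * z' * r1 = 0.
        by transitivity ((r0 + r1 * (1 * z')) - (r0 + r1 * (-1 * z')));
          [ring | rewrite h1 h2 subrr].
      have zz : 2%:R * z' != 0 by exact: mulf_neq0 (nz 1) z'n0.
      by rewrite mulf_eq0 (negPf zz) => /eqP.
    by split=> //; move: h1; rewrite r1z mul0r addr0.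
  - have -> : a * polar0 c a b - b * - polar1 c a b = 2%:R * z ^+ 2.
      by rewrite zE qform_polar; ring.
    by rewrite mulf_neq0 ?nz ?expf_neq0.
  - exact: infinite_param_slopes.
(* Two uses of [plane_vanish]: in (y0, y1) over each good fibre, then in the coordinates of x with
   respect to u and w. *)
have vanish R : (forall t, (has_point (qform (disc_form s idfun (line u w t))) /\ t \notin bad) ->
    exists a b a' b' (P : k -> Prop), [/\ a * b' - b * a' != 0, infinite P &
      forall l r m, l != 0 -> P r -> m != 0 ->
        eval_at idfun (cox_tuple (fun i => l * line u w t i) (m * (r * a + a')) (m * (r * b + b'))
          0) R = 0]) ->
    forall x0 x1 Y0 Y1, eval_at iota
      (cox_tuple (fun i => x0 * iota (u i) + x1 * iota (w i)) Y0 Y1 0) R = 0.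
  move=> RP x0 x1 Y0 Y1.
  have step l t : (has_point (qform (disc_form s idfun (line u w t))) /\ t \notin bad) -> l != 0 ->
      eval_at iota (cox_tuple (fun i => iota l * (iota t * iota (u i) + iota (w i))) Y0 Y1 0) R = 0.
    move=> tT ln0; have [a [b [a' [b' [P [det0 iP RP0]]]]]] := RP t tT.
    have detL : iota a * iota b' - iota b * iota a' != 0 by rewrite -!rmorphM -rmorphB fmorph_eq0.
    have H := @plane_vanish _ _ iota char0 R
      (cox_tuple (fun i => iota l * (iota t * iota (u i) + iota (w i))) 0 0 0)
      (cox_tuple (fun=> 0) (iota a) (iota b) 0) (cox_tuple (fun=> 0) (iota a') (iota b') 0) P iP.
    have := H _ ((Y0 * iota b' - Y1 * iota a') / (iota a * iota b' - iota b * iota a'))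
      ((Y1 * iota a - Y0 * iota b) / (iota a * iota b' - iota b * iota a')).
    move=> H'; rewrite -[RHS]H' => [|r m Pr mn0].
      apply: eval_at_ext => i; rewrite !cox_tuple_lin.
      rewrite (_ : 0 + _ * iota a + _ = Y0); last by field.
      rewrite (_ : 0 + _ * iota b + _ = Y1); last by field.
      by rewrite !mulr0 !addr0; apply: cox_tuple_ext => j /=; rewrite ?mulr0 ?addr0.
    have := RP0 l r m ln0 Pr mn0 => /(congr1 iota); rewrite rmorph0 -eval_at_fmorph => RP00.
    apply: etrans RP00; apply: eval_at_ext => i; rewrite -[i]splitK; case: (split i) => j /=.
      by rewrite !cox_tuple_x /line /= !(mulr0, addr0) rmorphM rmorphD rmorphM.
    by rewrite !cox_tuple_y; have [->|[->|->]] := ord3P j;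
      rewrite /= ?(rmorphM, rmorphD, rmorph0) /=; ring.
  have H := @plane_vanish _ _ iota char0 R (cox_tuple (fun=> 0) Y0 Y1 0)
      (cox_tuple (fun i => iota (u i)) 0 0 0) (cox_tuple (fun i => iota (w i)) 0 0 0) _ iT.
  rewrite -[RHS](H _ x0 x1) => [|t l tT ln0].
    apply: eval_at_ext => i; rewrite !cox_tuple_lin !mulr0 !addr0.
    by apply: cox_tuple_ext => j /=; rewrite add0r.
  apply: etrans (step l t tT ln0); apply: eval_at_ext => i; rewrite -[i]splitK; case: (split i) =>
    j /=.
    by rewrite !cox_tuple_x add0r.
  by rewrite !cox_tuple_y; have [->|[->|->]] := ord3P j; rewrite /= !(mulr0, addr0).
have xE : exists x0 x1, forall i, v (ix i) = x0 * iota (u i) + x1 * iota (w i).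
  have uwL : iota (u ord0) * iota (w ord_max) - iota (u ord_max) * iota (w ord0) != 0.
    by rewrite -!rmorphM -rmorphB fmorph_eq0.
  exists ((v (ix ord0) * iota (w ord_max) - v (ix ord_max) * iota (w ord0)) / (iota (u ord0) * iota
    (w ord_max) - iota (u ord_max) * iota (w ord0))).
  exists ((v (ix ord_max) * iota (u ord0) - v (ix ord0) * iota (u ord_max)) / (iota (u ord0) * iota
    (w ord_max) - iota (u ord_max) * iota (w ord0))).
  by move=> i; have [->|->] := ord2P i; field.
have [x0 [x1 {}xE]] := xE.
have vE : v =1 cox_tuple (fun i => x0 * iota (u i) + x1 * iota (w i)) (v (iy y0)) (v (iy y1))
  (v (iy y2)).
  by move=> i; rewrite [LHS]cox_tuple_eta; apply: cox_tuple_ext.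
rewrite (eval_at_ext _ _ vE) NF; last by rewrite -(eval_at_ext _ _ vE).
rewrite !vanish ?mul0r ?addr0 // => t /onfib[a [b [a' [b' [P [det0 iP RP]]]]]];
  exists a, b, a', b', P; split=> // l r m ln0 Pr mn0; by have [] := RP l r m ln0 Pr mn0.
Qed.
End Density.

(** * From density to a point on a smooth fibre *)

Lemma det_mx33 (R : comNzRingType) (M : 'M[R]_3) (i0 := ord0 : 'I_3) (i1 := lift ord0 ord0 : 'I_3)
  (i2 := lift ord0 (lift ord0 ord0) : 'I_3) :
  \det M = M i0 i0 * (M i1 i1 * M i2 i2 - M i1 i2 * M i2 i1)
    - M i0 i1 * (M i1 i0 * M i2 i2 - M i1 i2 * M i2 i0)
    + M i0 i2 * (M i1 i0 * M i2 i1 - M i1 i1 * M i2 i0).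
Proof.
rewrite (expand_det_row _ ord0) !big_ord_recl big_ord0 /cofactor.
rewrite !(expand_det_row _ ord0) !big_ord_recl !big_ord0 /cofactor !det_mx11 !mxE /=.
have e1 : lift (lift ord0 ord0) ord0 = ord0 :> 'I_3 by exact: val_inj.
have e2 : lift (lift ord0 ord0) (lift ord0 ord0) = i2 by exact: val_inj.
have e3 : lift i2 ord0 = ord0 by exact: val_inj.
have e4 : lift i2 (lift ord0 ord0) = i1 by exact: val_inj.
have e5 : lift (lift ord0 ord0) ord0 = ord0 :> 'I_2 by exact: val_inj.
rewrite ?e1 ?e2 ?e3 ?e4 ?e5 ?e1 ?e2 ?e3 ?e4 -/i0 -/i1 -/i2.
rewrite /bump /= !addn0 !add1n !expr0 !expr1 ?exprS ?expr0; ring.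
Qed.

Lemma mpoly_natE n (R : comNzRingType) m : m%:R = (m%:R)%:MP :> {mpoly R[n]}.
Proof. by rewrite rmorph_nat. Qed.

(** Links generic nondegeneracy of the conic bundle to the discriminant of F. *)
Lemma qdisc_det (k : fieldType) (s : conic_coeffs k) :
  qdisc (disc00 s, disc01 s, disc11 s) = - (8%:R * (s22 s)%:MP) * \det (polar_mx s).
Proof.
rewrite det_mx33 !mxE /= /qdisc /disc00 /disc01 /disc11 /=.
rewrite mpolyCM (_ : (4%:R)%:MP = 4%:R); last by rewrite -mpoly_natE.
move: (s00 s) (s01 s) (s02 s) (s11 s) (s12 s) (s22 s)%:MP => *; ring.
Qed.

Lemma homog_to_cox (k : fieldType) (p : {mpoly k[2]}) d : p \is d.-homog ->
  bihomogeneous (to_cox p).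
Proof.
move=> hp; exists (d%:Z, 0) => m.
rewrite /to_cox comp_mpolyEX => /msupp_sum_le /flattenP[_ /mapP[m' + ->]].
rewrite filter_predT => m'p /msuppZ_le.
rewrite comp_mpolyX (_ : \prod_(i < 2) _ =
  'X_[(U_(ix ord0) *+ m' ord0 + U_(ix ord_max) *+ m' ord_max)%MM]); last first.
  rewrite big_ord_recr big_ord1 (_ : widen_ord _ _ = ord0); last exact: val_inj.
  by rewrite /= !tnth_mktuple !mpolyXn -mpolyXD.
rewrite msuppX inE => /eqP ->; rewrite /cox_deg.
have x_ i : ((U_(ix ord0) *+ m' ord0 + U_(ix ord_max) *+ m' ord_max)%MM (ix i) = m' i)%N.
  rewrite mnmDE !mulmnE !mnm1E !(inj_eq (@lshift_inj _ _)).
  by have [->|->] := ord2P i; rewrite /= ?mul1n ?mul0n ?addn0.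
have y_ j : ((U_(ix ord0) *+ m' ord0 + U_(ix ord_max) *+ m' ord_max)%MM (iy j) = 0)%N.
  by rewrite mnmDE !mulmnE !mnm1E !eq_lrshift !mul0n.
rewrite !y_ (eq_bigr _ (fun i _ => x_ i)) (eq_bigr _ (fun j _ => y_ j)).
by rewrite sum_nat_const muln0 subr0 -(dhomog_mf hp m'p) /= mdegE.
Qed.

(** The tautological point (x0, x1) over the fraction field of k[x0, x1]. *)
Lemma generic_point (k : fieldType) :
  exists (L : fieldType) (iota : {rmorphism k -> L}) (x : 'I_2 -> L),
    forall p, (ev iota x p == 0) = (p == 0).
Proof.
pose L : fieldType := {fraction {mpoly k[2]}}.
pose iota : {rmorphism k -> L} := @tofrac {mpoly k[2]} \o @mpolyC 2 k.
pose x i : L := @tofrac {mpoly k[2]} 'X_i.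
exists L, iota, x => p; suff -> : ev iota x p = tofrac p by rewrite tofrac_eq0.
elim/mpoly_ring_ind: p => [c|i|p q IHp IHq|p q IHp IHq].
- by rewrite evC.
- by rewrite /ev map_mpolyX mevalXU.
- by rewrite [LHS](evD iota x) [X in X + _]IHp [X in _ + X]IHq tofracD.
- by rewrite [LHS](evM iota x) [X in X * _]IHp [X in _ * X]IHq tofracM.
Qed.

Section Forward.
Variables (k : fieldType) (s : conic_coeffs k).
Hypothesis char0 : [pchar k] =i pred0.
Hypothesis cb : conic_bundle_220 s.
Let s22n := s22_neq0 cb.

(** A singular point of the fibre has z = 0 and (y0, y1) in the kernel of the form, so y0 = y1 = 0
    and then y2 = 0. *)
Lemma smooth_fiber_of_qdisc (x : 'I_2 -> k) :
  qdisc (disc_form s idfun x) != 0 -> smooth_fiber s x.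
Proof.
move=> dn0 L iota w [[_ yn0] _] wx; apply: NNPP => nex.
have d0 j : eval_at iota w (conic_eq s)^`M(iy j) = 0.
  by apply/eqP; apply: contra_notT nex => h; exists j.
have nzL n : n.+1%:R != 0 :> L := pchar0_natr_neq0 (ext_pchar0 iota char0) n.
pose a := w (iy y0); pose b := w (iy y1); pose c := w (iy y2).
have {}d0 j : eval_at iota (cox_tuple (fun i => iota (x i)) a b c) (conic_eq s)^`M(iy j) = 0.
  rewrite -(d0 j); apply: eval_at_ext => i; rewrite [RHS]cox_tuple_eta.
  by apply: cox_tuple_ext => l; rewrite wx.
have z0 : zform s iota (fun i => iota (x i)) a b c = 0.
  rewrite -(d0 y2) eval_conic_dy2 !cox_tuple_y /=.
  by rewrite !(ev_ext _ _ (cox_tuple_x _ a b c)).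
have [] := conic_dy_eq0 z0; rewrite !d0 !mulr0 => P0 P1 _.
have [dA' dB' dC'] : [/\ ev iota (fun i => iota (x i)) (disc00 s) = iota (ev idfun x (disc00 s)),
    ev iota (fun i => iota (x i)) (disc01 s) = iota (ev idfun x (disc01 s))
  & ev iota (fun i => iota (x i)) (disc11 s) = iota (ev idfun x (disc11 s))].
  by split; rewrite -ev_comp.
pose q := disc_form s iota (fun i => iota (x i)).
have dL : qdisc q != 0.
  rewrite /q /disc_form dA' dB' dC' /qdisc /= -(rmorph_nat iota) -!rmorphM -rmorphXn -rmorphB.
  by rewrite fmorph_eq0.
have a0 : a = 0.
  have /eqP : qdisc q * a = 0.
    transitivity (q.1.2 * polar1 q a b - 2%:R * q.2 * polar0 q a b);
      last by rewrite P0 P1 !mulr0 subr0.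
    by rewrite /qdisc /polar0 /polar1; case: (q) => -[q0 q1] q2 /=; ring.
  by rewrite mulf_eq0 (negPf dL) => /eqP.
have b0 : b = 0.
  have /eqP : qdisc q * b = 0.
    transitivity (q.1.2 * polar0 q a b - 2%:R * q.1.1 * polar1 q a b);
      last by rewrite P0 P1 !mulr0 subr0.
    by rewrite /qdisc /polar0 /polar1; case: (q) => -[q0 q1] q2 /=; ring.
  by rewrite mulf_eq0 (negPf dL) => /eqP.
have c0 : c = 0.
  move: z0; rewrite a0 b0 /zform !mulr0 !add0r => /eqP.
  by rewrite !mulf_eq0 (negPf (nzL 1)) fmorph_eq0 (negPf s22n) => /eqP.
by have [j] := yn0; have [->|[->|->]] := ord3P j; rewrite -?/a -?/b -?/c ?a0 ?b0 ?c0 eqxx.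
Qed.

Lemma disc_poly_neq0 : qdisc (disc00 s, disc01 s, disc11 s) != 0.
Proof.
case: cb => _ _ _ det0; rewrite qdisc_det mulf_neq0 // oppr_eq0 mulf_neq0 ?mpolyC_eq0 //.
by rewrite mpoly_natE mpolyC_eq0 (pchar0_natr_neq0 char0 7).
Qed.

Lemma disc_poly_homog : qdisc (disc00 s, disc01 s, disc11 s) \is 8.-homog.
Proof.
have [hA hB hC] := disc_homog cb.
rewrite /qdisc /= -mulrA; apply: rpredB; first by rewrite expr2 (dhomogM hB hB).
by rewrite mpoly_natE mul_mpolyC dhomogZ // (dhomogM hA hC).
Qed.

(** Otherwise every k-point lies in the closed set where the discriminant vanishes, but a point over
    the generic point of P^1 does not. *)
Lemma point_on_smooth_fiber_of_dense :
  rational_points_dense s -> has_rational_point_on_smooth_fiber s.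
Proof.
move=> dense; apply: NNPP => nex.
set Q := qdisc (disc00 s, disc01 s, disc11 s).
have evQ (L : fieldType) (iota : {rmorphism k -> L}) x : ev iota x Q = qdisc (disc_form s iota x).
  rewrite /Q /disc_form; move: (disc00 s) (disc01 s) (disc11 s) => A B C.
  by rewrite /qdisc /= !expr2 mpoly_natE !(evD, evN, evM) evC rmorph_nat.
have Qk v : rational_point s v -> eval_at idfun v (to_cox Q) = 0.
  move=> vP; apply/eqP; apply: contra_notT nex; rewrite eval_to_cox evQ => dn0.
  by exists v; split=> //; apply: smooth_fiber_of_qdisc.
have [L0 [gen [x0 genE]]] := generic_point k.
have char0L0 := ext_pchar0 gen char0.
(* Over the generic point, (y0, y1) = (1, 0) lifts to the surface once a square root of [disc00] is
   adjoined. *)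
pose p : {poly L0} := 'X^2 - (ev gen x0 (disc00 s))%:P.
have sz : (1 < size p)%N by rewrite size_XnsubC.
have [M [g [r]]] := root_in_extension sz.
rewrite rmorphB /= map_polyC map_polyXn rootE !hornerE subr_eq0 => /eqP rE.
pose x i := g (x0 i).
have [c cE] := zform_surj (g \o gen) char0 s22n x 1 0 r.
have con : point_on s (g \o gen) (cox_tuple x 1 0 c).
  split; last first.
    apply/(on_conicP (g \o gen) char0 s22n); rewrite cE rE /disc_form !ev_comp /qform /=.
    by rewrite expr1n mulr1 mulr0 expr0n mulr0 !addr0.
  split; last by exists y0; rewrite cox_tuple_y oner_eq0.
  exists ord0; rewrite cox_tuple_x /x fmorph_eq0.
  have -> : x0 ord0 = ev gen x0 'X_ord0 by rewrite /ev map_mpolyX mevalXU.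
  by rewrite genE -msize_poly_eq0 msizeX.
have S_homog F : F = to_cox Q -> bihomogeneous F.
  by move=> ->; exact: (homog_to_cox disc_poly_homog).
have S_vanish v : rational_point s v -> in_zero_locus (fun F => F = to_cox Q) idfun v.
  by move=> vP F ->; exact: Qk.
have := dense _ S_homog S_vanish M (g \o gen) _ con (to_cox Q) erefl.
rewrite eval_to_cox (ev_ext _ _ (cox_tuple_x x 1 0 c)) ev_comp => /eqP.
by rewrite fmorph_eq0 genE (negPf disc_poly_neq0).
Qed.
End Forward.

Theorem proposition4p7 (k : fieldExtType rat) (s : conic_coeffs k) :
  conic_bundle_220 s -> smooth_total_space s ->
  (rational_points_dense s <-> has_rational_point_on_smooth_fiber s).
Proof.
move=> cb smooth.
have char0 : [pchar k] =i pred0.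
  by move=> p; rewrite (fmorph_pchar (in_alg k)) Num.Theory.pchar_num.
split; first exact: point_on_smooth_fiber_of_dense.
case=> v [vP sm]; pose u i := v (ix i).
have [dn0 pt] := smooth_fiber_point char0 cb vP sm.
(* Completing [u] to a basis places the given smooth fibre at t = oo. *)
have [w uw] : exists w : 'I_2 -> k, u ord0 * w ord_max - u ord_max * w ord0 != 0.
  have [[[i ui] _] _] := vP.
  have [iE|iE] := ord2P i; rewrite iE in ui.
    by exists (fun j => (j == ord_max)%:R); rewrite /= mulr1 mulr0 subr0.
  by exists (fun j => (j == ord0)%:R); rewrite /= mulr1 mulr0 sub0r oppr_eq0.
apply: (dense_of_infinite_good_fibres char0 cb uw dn0).
exact: infinite_good_fibres.
Qed.
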